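(* Let $X$ be a compact Hausdorff space and let $h$ be an aperiodic homeomorphism of $X$. Then the following are equivalent: (i) $h$ is strongly p.p.m.; (ii) there is a partition of $X$ into clopen spaces $X_1,\dots,X_m$ such that $(X_1,h),\dots,(X_m,h)$ are compact minimal systems that lie in a single flip Kakutani equivalence class.
   Context: A homeomorphism is aperiodic if it has no finite orbits. A homeomorphism $g$ of a Hausdorff space $X$ is minimal if $X\neq\emptyset$ and the only proper closed subset $K\subsetneq X$ with $gK\subseteq K$ is $K=\emptyset$. A compact minimal system $(X,g)$ is an infinite compact Hausdorff space $X$ with a minimal homeomorphism $g$ of $X$. The topological full group $\tau[g]$ is the group of all homeomorphisms $h$ of $X$ for which there is a locally constant $c:X\to\mathbb{Z}$ with $hx=g^{c(x)}x$ for all $x$. For $(X,g)$ a compact minimal system and $h\in\tau[g]$, the orbit number $o_g(h)$ is the number of infinite $h$-orbits contained in a $g$-orbit; this is finite and does not depend on the $g$-orbit. (It equals $o_g^+(h)+o_g^-(h)$, the numbers of positive and negative $h$-orbits in each $g$-orbit.) A homeomorphism $h$ of a compact Hausdorff space $X$ is piecewise a power of a minimal homeomorphism (p.p.m.) if $X=\emptyset$ or there is a minimal homeomorphism $g$ of $X$ with $h\in\tau[g]$. For $h$ p.p.m., $o_{\min}(h)$ is $0$ if $X$ is finite, and otherwise the least value of $o_g(h)$ over all minimal homeomorphisms $g$ of $X$ with $h\in\tau[g]$; $m(h)$ is the number of distinct infinite minimal orbit closures of $h$. $h$ is strongly p.p.m. if it is p.p.m. and $o_{\min}(h)=m(h)$.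 For a compact minimal system $(X,g)$ and nonempty clopen $Y\subseteq X$, the induced transformation $g_Y:Y\to Y$ is $g_Yx=g^tx$ with $t$ the least positive integer such that $g^tx\in Y$. Compact minimal systems $(X_1,h_1)$, $(X_2,h_2)$ are Kakutani equivalent if there are nonempty clopen $Y_i\subseteq X_i$ and a homeomorphism $\kappa:Y_1\to Y_2$ with $\kappa\circ(h_1)_{Y_1}=(h_2)_{Y_2}\circ\kappa$; they are flip Kakutani equivalent if $(X_1,h_1)$ is Kakutani equivalent to $(X_2,h_2)$ or to $(X_2,h_2^{-1})$. Both are equivalence relations. *)

(* Defs.v *)
From HB Require Import structures.
From mathcomp Require Import all_boot all_order all_algebra.
From mathcomp Require Import all_classical.
From mathcomp Require Import topology.

Set Implicit Arguments.
Unset Strict Implicit.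
Unset Printing Implicit Defensive.

Local Open Scope classical_set_scope.
Local Open Scope card_scope.

Record homeo (X Y : topologicalType) := Homeo {
  homeo_fun :> X -> Y;
  homeo_inv : Y -> X;
  homeo_funK : cancel homeo_fun homeo_inv;
  homeo_invK : cancel homeo_inv homeo_fun;
  homeo_cts : continuous homeo_fun;
  homeo_inv_cts : continuous homeo_inv }.

Definition inv_homeo (X Y : topologicalType) (f : homeo X Y) : homeo Y X :=
  Homeo (homeo_invK f) (homeo_funK f) 
    (@homeo_inv_cts _ _ f) (@homeo_cts _ _ f).

Definition zpow (X : topologicalType) (g : homeo X X) (n : int) : X -> X :=
  match n with
  | Posz k => iter k g
  | Negz k => iter k.+1 (inv_homeo g)
  end.

Definition zorbit (X : topologicalType) (g : homeo X X) (x : X) : set X :=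
  range (fun n : int => zpow g n x).

Definition aperiodic (X : topologicalType) (g : homeo X X) : Prop :=
  forall x, infinite_set (zorbit g x).

Definition minimal (X : topologicalType) (g : homeo X X) : Prop :=
  [set: X] !=set0 /\
  forall K : set X, closed K -> K != setT -> g @` K `<=` K -> K = set0.

Definition compact_minimal (X : topologicalType) (g : homeo X X) : Prop :=
  [/\ infinite_set [set: X], compact [set: X], hausdorff_space X & minimal g].

Definition locally_constant (X : topologicalType) (T : Type) (c : X -> T) :=
  forall x, \forall y \near x, c y = c x.

Definition full_group (X : topologicalType) (g : homeo X X) :
    set (homeo X X) :=
  [set h | exists c : X -> int,
     locally_constant c /\ forall x, h x = zpow g (c x) x].

(* o_g(h) = n.  The orbit number does not depend on the g-orbit in which the
   infinite h-orbits are counted, hence the quantification over x. *)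
Definition orbit_number (X : topologicalType) (g h : homeo X X) (n : nat) :=
  forall x : X,
    [set O | infinite_set O /\ exists2 y, O = zorbit h y & O `<=` zorbit g x]
      #= `I_n.

Definition ppm (X : topologicalType) (h : homeo X X) : Prop :=
  [set: X] = set0 \/ exists2 g : homeo X X, minimal g & full_group g h.

(* o_min(h) = n, for h p.p.m. *)
Definition min_orbit_number (X : topologicalType) (h : homeo X X) (n : nat) :=
  (finite_set [set: X] /\ n = 0%N) \/
  [/\ infinite_set [set: X],
      exists g : homeo X X, [/\ minimal g, full_group g h & orbit_number g h n]
    & forall (g : homeo X X) (k : nat),
        minimal g -> full_group g h -> orbit_number g h k -> (n <= k)%N].

Section restriction.
Variables (X : topologicalType) (h : homeo X X) (A : set X).
Hypothesis hA : h @` A = A.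

Lemma restr_fun_subproof (x : A) : h (set_val x) \in A.
Proof.
have hAA y : A y -> A (h y) by move=> Ay; rewrite -hA; exists y.
by apply/mem_set/hAA; exact: set_valP.
Qed.

Lemma restr_inv_subproof (x : A) : homeo_inv h (set_val x) \in A.
Proof.
have hAA y : A y -> A (homeo_inv h y).
  by rewrite -{1}hA => -[z Az <-]; rewrite homeo_funK.
by apply/mem_set/hAA; exact: set_valP.
Qed.

Definition restr_fun (x : A) : A := SigSub (restr_fun_subproof x).
Definition restr_inv (x : A) : A := SigSub (restr_inv_subproof x).

Lemma restr_funK : cancel restr_fun restr_inv.
Proof. by move=> x; apply: val_inj; rewrite /= set_valE /= homeo_funK. Qed.

Lemma restr_invK : cancel restr_inv restr_fun.
Proof. by move=> x; apply: val_inj; rewrite /= set_valE /= homeo_invK. Qed.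

Lemma restr_fun_cts : continuous restr_fun.
Proof.
apply: (@continuous_comp_initial A A X set_val) => x.
apply: (@continuous_comp A X X set_val h); last exact: homeo_cts.
exact: initial_continuous.
Qed.

Lemma restr_inv_cts : continuous restr_inv.
Proof.
apply: (@continuous_comp_initial A A X set_val) => x.
apply: (@continuous_comp A X X set_val (homeo_inv h)); last exact: homeo_inv_cts.
exact: initial_continuous.
Qed.

Definition restr : homeo A A :=
  Homeo restr_funK restr_invK restr_fun_cts restr_inv_cts.

End restriction.

Arguments restr {X} h {A} hA.

Definition infinite_minimal_orbit_closures (X : topologicalType)
    (h : homeo X X) : set (set X) :=
  [set C | [/\ exists x, C = closure (zorbit h x), infinite_set C
             & exists hC : h @` C = C, minimal (restr h hC)]].

Definition strongly_ppm (X : topologicalType) (h : homeo X X) : Prop :=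
  ppm h /\
  exists n, min_orbit_number h n /\ infinite_minimal_orbit_closures h #= `I_n.

Definition returns (X : topologicalType) (g : homeo X X) (Y : set X) (x : X) :
    pred nat :=
  fun t => (0 < t)%N && `[< Y (iter t g x) >].

(* The value 0 when the forward orbit never returns to Y is a dummy; it does not
   occur for a nonempty open Y in a compact minimal system. *)
Definition return_time (X : topologicalType) (g : homeo X X) (Y : set X)
    (x : X) : nat :=
  if pselect (exists t, returns g Y x t) is left ex then ex_minn ex else 0%N.

Lemma return_timeP (X : topologicalType) (g : homeo X X) (Y : set X) (x : Y) :
  iter (return_time g Y (set_val x)) g (set_val x) \in Y.
Proof.
rewrite /return_time; case: pselect => [ex|_] /=.
  by case: ex_minnP => t /andP[_ /asboolP Yt] _; exact/mem_set.
by apply/mem_set; exact: set_valP.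
Qed.

Definition induced (X : topologicalType) (g : homeo X X) (Y : set X) (x : Y) :
    Y :=
  SigSub (return_timeP g x).

Definition kakutani (X1 X2 : topologicalType) (h1 : homeo X1 X1)
    (h2 : homeo X2 X2) : Prop :=
  exists (Y1 : set X1) (Y2 : set X2),
    [/\ Y1 !=set0, clopen Y1, Y2 !=set0, clopen Y2
      & exists k : homeo Y1 Y2, forall y, k (induced h1 y) = induced h2 (k y)].

Definition flip_kakutani (X1 X2 : topologicalType) (h1 : homeo X1 X1)
    (h2 : homeo X2 X2) : Prop :=
  kakutani h1 h2 \/ kakutani h1 (inv_homeo h2).

(* Main.v *)
(** (i) => (ii). If [g] is minimal and [h] is an aperiodic element of its full
    group, a forward [h]-orbit is syndetic in one direction of its [g]-orbit, so
    finitely many [g]-translates of any nonempty closed [h]-invariant set cover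
    the space; hence such sets have interior, and (boundaries being closed and
    invariant) are clopen.  Orbit closures of [h] are therefore clopen and
    minimal.  When [o_g(h) = m(h)], each [g]-orbit meets each piece [P] in a
    single [h]-orbit, so [h] and the induced map of [g] on [P] have the same
    orbits, with locally constant cocycle; by Boyle's argument they are flip
    conjugate.  Any two induced maps of [g] are Kakutani equivalent.

    (ii) => (i). Flip [h] on some pieces so that all of them become Kakutani
    equivalent to the first one.  Glue the pieces one at a time: given [kap]
    from [Y] to [Z] conjugating the induced maps of [F] on [Y] (in [A]) and on
    [Z] (in [B]), insert the [F]-excursion starting at [kap y] just before [y].
    The resulting map is minimal on the union of [A] and [B], and its first
    return maps to [A] and to [B] are both [F].  This gives a minimal [g] whose
    orbits meet each piece in one [h]-orbit; fewer is impossible since pieces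
    are open and [g]-orbits dense. *)

Require Import Defs.
From HB Require Import structures.
From mathcomp Require Import all_boot all_order all_algebra.
From mathcomp Require Import all_classical.
From mathcomp Require Import topology.
From mathcomp Require Import zify.

Set Implicit Arguments.
Unset Strict Implicit.
Unset Printing Implicit Defensive.

Import Order.TTheory GRing.Theory Num.Theory.

Local Open Scope classical_set_scope.
Local Open Scope card_scope.

(** * Powers, local powers and orbits *)

Section powers.
Context {X : topologicalType}.
Implicit Types (g F G : homeo X X) (x y : X) (n m : int).
Local Open Scope ring_scope.

Lemma zpowS g n x : zpow g (n + 1) x = g (zpow g n x).
Proof.
case: n => n; first by rewrite -PoszD addn1.
case: n => [|n]; first by rewrite /= homeo_invK.
have -> : Negz n.+1 + 1 = Negz n by lia.
by rewrite [in RHS]/= homeo_invK.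
Qed.

Lemma zpowD g n m x : zpow g (n + m) x = zpow g n (zpow g m x).
Proof.
elim: n => [|n IH|n IH]; first by rewrite add0r.
  by rewrite -addn1 PoszD addrAC !zpowS IH.
apply: (can_inj (homeo_funK g)); rewrite -!zpowS.
have -> : - n.+1%:Z + m + 1 = - n%:Z + m by lia.
by have -> : - n.+1%:Z + 1 = - n%:Z by lia.
Qed.

Lemma zpowNK g n x : zpow g (- n) (zpow g n x) = x.
Proof. by rewrite -zpowD addNr. Qed.

Lemma zpowKN g n x : zpow g n (zpow g (- n) x) = x.
Proof. by rewrite -zpowD subrr. Qed.

Lemma zpow_inv g n x : zpow (inv_homeo g) n x = zpow g (- n) x.
Proof.
elim: n => [//|n IH|n IH].
  rewrite -addn1 PoszD zpowS IH; apply: (can_inj (homeo_funK g)).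
  rewrite homeo_invK -zpowS; congr (zpow _ _ _); lia.
rewrite opprK in IH *; apply: (can_inj (homeo_invK g)).
have := zpowS (inv_homeo g) (- n.+1%:Z) x.
have -> : - n.+1%:Z + 1 = - n%:Z by lia.
by move=> /= <-; rewrite IH.
Qed.

Lemma iter_cts (f : X -> X) k : continuous f -> continuous (iter k f).
Proof.
move=> fc; elim: k => [|k IH] x; first exact: cvg_id.
by apply: (@continuous_comp _ _ _ (iter k f) f); [exact: IH|exact: fc].
Qed.

Lemma zpow_cts g n : continuous (zpow g n).
Proof. by case: n => n; apply: iter_cts; exact: homeo_cts. Qed.

Lemma iter_inv g k x : iter k (inv_homeo g) (iter k g x) = x.
Proof. by elim: k x => // k IH x; rewrite iterSr /= homeo_funK IH. Qed.

Lemma iter_inv_sub g r s x : (s <= r)%N ->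
  iter s (inv_homeo g) (iter r g x) = iter (r - s) g x.
Proof. by move=> sr; rewrite -{1}(subnKC sr) iterD iter_inv. Qed.

Lemma zorbit_refl g x : zorbit g x x. Proof. by exists 0. Qed.

Lemma zorbit_zpow g n x : zorbit g x (zpow g n x). Proof. by exists n. Qed.

Lemma zorbit_eq g x y : zorbit g x y -> zorbit g x = zorbit g y.
Proof.
move=> [n _ <-]; apply/seteqP; split=> _ [m _ <-].
  by exists (m - n) => //; rewrite -zpowD subrK.
by exists (m + n) => //; rewrite zpowD.
Qed.

Lemma zorbit_inv g x : zorbit (inv_homeo g) x = zorbit g x.
Proof.
apply/seteqP; split=> _ [m _ <-]; exists (- m) => //; first by rewrite zpow_inv.
by rewrite zpow_inv opprK.
Qed.

Lemma invariant_zpow g (A : set X) n x : (forall y, A y -> A (g y)) ->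
  (forall y, A y -> A (homeo_inv g y)) -> A x -> A (zpow g n x).
Proof. by move=> Ag Ai Ax; case: n => n; elim: n => [|n IH] /=; auto. Qed.

Lemma periodic_zorbit_finite g x k : (0 < k)%N -> iter k g x = x ->
  finite_set (zorbit g x).
Proof.
move=> k0 xk.
apply: (@sub_finite_set _ _ [set iter i g x | i in `I_k]); last first.
  exact/finite_image/finite_II.
have xq q : zpow g (q * k%:Z) x = x.
  elim: q => [|q IH|q IH]; first by rewrite mul0r.
    by rewrite -addn1 PoszD mulrDl mul1r zpowD /= xk.
  have -> : - q.+1%:Z * k = - k%:Z + - q%:Z * k by lia.
  by rewrite zpowD IH -[in LHS]xk -[iter k g x]/(zpow g k x) zpowNK.
move=> _ [n _ <-]; rewrite (divz_eq n k) addrC zpowD xq.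
have : 0 <= (n %% k)%Z by rewrite modz_ge0; lia.
have : (n %% k)%Z < k by rewrite ltz_pmod; lia.
by case: (n %% k)%Z => // i ik _; exists i.
Qed.

Lemma zpow_inj g x n m : infinite_set (zorbit g x) ->
  zpow g n x = zpow g m x -> n = m.
Proof.
move=> inf.
suff wl p q : zpow g p x = zpow g q x -> ~~ (p < q).
  move=> e; have := wl _ _ e; have := wl _ _ (esym e); lia.
move=> e; apply/negP => pq; apply: inf.
apply: (@periodic_zorbit_finite _ _ `|q - p|%N); first lia.
rewrite -[iter _ _ _]/(zpow g `|q - p|%N x).
have -> : (`|q - p|%N : int) = - p + q by lia.
by rewrite zpowD -e zpowNK.
Qed.

(** Pointwise form of full group membership: it applies to maps that are not bundled homeomorphisms
    and can be checked separately on each clopen piece. *)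
Definition local_power F (f : X -> X) x :=
  exists n, \forall y \near x, f y = zpow F n y.

Lemma near_eq_continuous (Y : topologicalType) (f f' : X -> Y) x :
  (\forall y \near x, f y = f' y) -> {for x, continuous f'} ->
  {for x, continuous f}.
Proof.
move=> ff' f'x U; rewrite (nbhs_singleton ff') => /f'x /= f'U.
by apply: filterS2 ff' f'U => y /= ->.
Qed.

Lemma local_power_continuous F f x :
  local_power F f x -> {for x, continuous f}.
Proof. by case=> n /near_eq_continuous; apply; exact: zpow_cts. Qed.

Lemma local_power_comp F f f' x :
  local_power F f x -> local_power F f' (f x) -> local_power F (f' \o f) x.
Proof.
move=> fx [m f'x]; have fc := local_power_continuous fx.
case: fx => n fx; exists (m + n).
have /= := near_fun _ _ _ fc f'x; apply: filterS2 fx => y fy f'y /=.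
by rewrite f'y fy zpowD.
Qed.

Lemma local_power_zpow F G (A : set X) n x : (forall y, A y -> A (F y)) ->
  (forall y, A y -> A (homeo_inv F y)) ->
  (forall y, A y -> local_power G F y) -> A x -> local_power G (zpow F n) x.
Proof.
move=> AF Ai lF Ax.
have li y : A y -> local_power G (homeo_inv F) y.
  move=> Ay; have [m Gm] := lF _ (Ai _ Ay); exists (- m).
  have /= := near_fun _ _ _ (@homeo_inv_cts _ _ F y) Gm.
  by apply: filterS => z; rewrite homeo_invK => {2}->; rewrite zpowNK.
case: n => n.
  elim: n => [|n IH]; first by exists 0; exact: nearW.
  apply: (local_power_comp IH); apply: lF.
  exact: (@invariant_zpow F A n).
have l0 : local_power G id x by exists 0; exact: nearW.
elim: n => [|n IH]; first exact: (local_power_comp l0 (li _ Ax)).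
apply: (local_power_comp IH); apply: li.
exact: (@invariant_zpow F A (Negz n)).
Qed.

Lemma local_power_trans F G (A : set X) f x : (forall y, A y -> A (F y)) ->
  (forall y, A y -> A (homeo_inv F y)) ->
  (forall y, A y -> local_power G F y) -> A x ->
  local_power F f x -> local_power G f x.
Proof.
move=> AF Ai lF Ax [n fn].
have [m Gm] := local_power_zpow n AF Ai lF Ax.
by exists m; apply: filterS2 fn Gm => y -> ->.
Qed.

(** Aperiodicity makes the exponent at each point unique, so independently chosen local exponents
    agree on neighbourhoods. *)
Lemma local_power_full_group g (h : homeo X X) : aperiodic g ->
  (forall x, local_power g h x) -> full_group g h.
Proof.
move=> ag lh; pose c x := projT1 (cid (lh x)).
have cP x : \forall y \near x, h y = zpow g (c x) y.
  by rewrite /c; case: cid.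
exists c; split=> [x|x]; last exact: nbhs_singleton (cP x).
apply: filterS (cP x) => y hy; apply: (zpow_inj (ag y)).
by rewrite -hy; symmetry; exact: nbhs_singleton (cP y).
Qed.

Lemma full_group_local_power g (h : homeo X X) x : full_group g h ->
  local_power g h x.
Proof. by case=> c [lc hc]; exists (c x); apply: filterS (lc x) => y <-. Qed.

(** Near-covering form of compactness for the filter of large [k]; monotonicity makes a local bound
    valid for all larger [k] at once. *)
Lemma compact_bound (K : set X) (R : X -> nat -> Prop) : compact K ->
  (forall x k l, (k <= l)%N -> R x k -> R x l) ->
  (forall x, K x -> exists k, \forall y \near x, R y k) ->
  exists k, forall x, K x -> R x k.
Proof.
move=> /compact_near_coveringP cK mono loc.
have [|N _ KN] := cK nat eventually (fun k x => R x k) _.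
  move=> x /loc [k Rk].
  exists ([set y | R y k], [set l | (k <= l)%N]) => /=.
    by split=> //; exists k.
  by move=> [y l] /= [Ry kl]; exact: mono Ry.
by exists N; exact: (KN N (leqnn N)).
Qed.

End powers.

(** * First returns and minimality *)

Section returns.
Context {X : topologicalType}.
Implicit Types (F : homeo X X) (S A : set X) (x y : X).

(** A relation instead of a function: no default value is involved, and inverting or conjugating [f]
    acts on it directly. *)
Definition first_return (f : X -> X) S x y :=
  [/\ S x, S y & exists r, [/\ (0 < r)%N, iter r f x = y &
    forall s, (0 < s < r)%N -> ~ S (iter s f x)]].

Lemma first_return_uniq f S x y y' :
  first_return f S x y -> first_return f S x y' -> y = y'.
Proof.
move=> [_ Sy [r [r0 ry rS]]] [_ Sy' [r' [r'0 r'y' r'S]]].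
case: (ltngtP r r') => rr'; last by rewrite -ry -r'y' rr'.
- by case: (r'S r); rewrite ?r0 // ry.
- by case: (rS r'); rewrite ?r'0 // r'y'.
Qed.

Lemma first_return_ex f S x : S x -> (exists2 r, (0 < r)%N & S (iter r f x)) ->
  exists y, first_return f S x y.
Proof.
move=> Sx ex.
have ex' : exists r, (0 < r)%N && `[< S (iter r f x) >].
  by case: ex => r r0 Sr; exists r; rewrite r0; apply/asboolP.
case: (ex_minnP ex') => r /andP[r0 /asboolP Sr] rmin.
exists (iter r f x); split=> //; exists r; split=> // s /andP[s0 sr] Ss.
by have := rmin s; rewrite s0 leqNgt sr => /(_ (asboolT Ss)).
Qed.

Lemma first_return_inv F S x y :
  first_return F S x y -> first_return (inv_homeo F) S y x.
Proof.
move=> [Sx Sy [r [r0 ry rS]]]; split=> //; exists r; split=> //.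
  by rewrite -ry iter_inv.
move=> s sr; rewrite -ry iter_inv_sub; last by lia.
by apply: rS; lia.
Qed.

Lemma near_preimage (Y : topologicalType) (f : X -> Y) (U : set Y) x :
  {for x, continuous f} -> open U -> U (f x) -> \forall y \near x, U (f y).
Proof. by move=> fx oU Ux; apply: fx; exact: open_nbhs_nbhs. Qed.

Lemma near_open (U : set X) x : open U -> U x -> \forall y \near x, U y.
Proof. by move=> oU Ux; exact: open_nbhs_nbhs. Qed.

Lemma near_forall_lt (P : nat -> X -> Prop) r x :
  (forall s, (s < r)%N -> \forall y \near x, P s y) ->
  \forall y \near x, forall s, (s < r)%N -> P s y.
Proof.
elim: r => [|r IH] nP; first exact: nearW.
have nPr : \forall y \near x, P r y by apply: nP.
apply: filterS2 (IH _) nPr => [y yr Pr s|s sr]; last by apply: nP; lia.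
by rewrite ltnS leq_eqVlt => /orP[/eqP->|]; auto.
Qed.

(** The return time [r] is fixed by finitely many conditions of being in or out of [S], all open
    because [S] is clopen. *)
Lemma first_return_near F S x y : clopen S -> first_return F S x y ->
  exists r, [/\ (0 < r)%N, iter r F x = y,
    forall s, (0 < s < r)%N -> ~ S (iter s F x)
    & \forall z \near x, first_return F S z (iter r F z)].
Proof.
move=> [oS cS] [Sx Sy [r [r0 ry rS]]]; exists r; split=> //.
have Fc k := @iter_cts _ F k (@homeo_cts _ _ F).
have nS : \forall z \near x, forall s, (s < r)%N -> (0 < s)%N ->
    (~` S) (iter s F z).
  apply: near_forall_lt => s sr; case: s sr => [|s] sr; first exact: nearW.
  have := near_preimage (Fc s.+1 x) (closed_openC cS) (rS s.+1 sr).
  by apply: filterS.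
have nSr : \forall z \near x, S (iter r F z).
  by apply: near_preimage => //; [exact: Fc|rewrite ry].
apply: filterS3 (near_open oS Sx) nSr nS => z Sz Sr nS.
by split=> //; exists r; split=> // s /andP[s0 sr]; exact: nS.
Qed.

(** Minimality of the restriction to [A], phrased inside [X] so that different maps and pieces can
    be compared without subtypes; nonemptiness of [A] is kept separate. *)
Definition minimal_on F A :=
  [/\ forall x, A x -> A (F x), forall x, A x -> A (homeo_inv F x) &
    forall K, closed K -> K !=set0 -> K `<=` A -> (forall x, K x -> K (F x)) ->
      A `<=` K].

Lemma minimal_on_iter F A k x : minimal_on F A -> A x -> A (iter k F x).
Proof. by move=> [AF _ _] Ax; elim: k => //= k; exact: AF. Qed.

Lemma closure_invariant F (A : set X) :
  (forall x, A x -> A (F x)) -> forall x, closure A x -> closure A (F x).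
Proof.
move=> AF x Ax B /(@homeo_cts _ _ F) /Ax [y [Ay By]].
by exists (F y); split=> //; exact: AF.
Qed.

(** The closure of the strictly positive half-orbit of [x] is closed and forward invariant, hence
    contains [A]. *)
Lemma minimal_on_enter F A (U : set X) x : minimal_on F A -> closed A ->
  open U -> A `&` U !=set0 -> A x -> exists2 r, (0 < r)%N & U (iter r F x).
Proof.
move=> mF cA oU [u [Au Uu]] Ax.
pose K := closure [set iter r F x | r in [set r | (0 < r)%N]].
have KA : K `<=` A.
  rewrite (closure_id A).1 //; apply: closureS => _ [r _ <-].
  exact: minimal_on_iter.
have AK : A `<=` K.
  case: mF => AF _; apply => //; first exact: closed_closure.
  - by exists (F x); apply: subset_closure; exists 1%N.
  - by apply: closure_invariant => _ [r _ <-]; exists r.+1.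
have [_ [[r r0 <-] Ur]] := AK u Au U (open_nbhs_nbhs (conj oU Uu)).
by exists r.
Qed.

Lemma minimal_on_enter_bound F A (U : set X) : minimal_on F A -> closed A ->
  compact A -> open U -> A `&` U !=set0 ->
  exists M, forall x, A x -> exists2 r, (0 < r <= M)%N & U (iter r F x).
Proof.
move=> mF cA coA oU AU.
apply: (@compact_bound _ A
  (fun x M => exists2 r, (0 < r <= M)%N & U (iter r F x))) => //.
  by move=> x k l kl [r rk Ur]; exists r => //; lia.
move=> x Ax; have [r r0 Ur] := minimal_on_enter mF cA oU AU Ax.
exists r; have Fc := @iter_cts _ F r (@homeo_cts _ _ F) x.
by apply: filterS (near_preimage Fc oU Ur) => y; exists r => //; lia.
Qed.

(** Go back [M + 1] steps, where [M] bounds all entrance times into [U]: the next entrance happens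
    strictly before returning to [x]. *)
Lemma minimal_on_enter_back F A (U : set X) x : minimal_on F A -> closed A ->
  compact A -> open U -> A `&` U !=set0 -> A x ->
  exists2 r, (0 < r)%N & U (iter r (inv_homeo F) x).
Proof.
move=> mF cA coA oU AU Ax.
have [M MP] := minimal_on_enter_bound mF cA coA oU AU.
have Ai k : A (iter k (inv_homeo F) x).
  by case: mF => _ Ai _; elim: k => //= k; exact: Ai.
have [r rM Ur] := MP _ (Ai M.+1).
exists (M.+1 - r)%N; first lia.
have <- : iter r F (iter M.+1 (inv_homeo F) x) =
    iter (M.+1 - r) (inv_homeo F) x by rewrite (iter_inv_sub (inv_homeo F)) //;
      lia.
exact: Ur.
Qed.

(** Extending by the identity off [S] gives a homeomorphism of all of [X]. Return times are locally
    constant, hence continuity, and the inverse is the same construction for the inverse of [F]. *)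
Lemma induced_homeo F S : clopen S ->
  (forall x, S x -> exists2 r, (0 < r)%N & S (iter r F x)) ->
  (forall x, S x -> exists2 r, (0 < r)%N & S (iter r (inv_homeo F) x)) ->
  exists J : homeo X X, (forall x, S x -> first_return F S x (J x)) /\
    (forall x, ~ S x -> J x = x).
Proof.
have JP G : (forall x, S x -> exists2 r, (0 < r)%N & S (iter r G x)) ->
    forall x, S x -> first_return G S x (xget x (first_return G S x)).
  move=> ret x Sx; have [y xy] := first_return_ex Sx (ret x Sx).
  exact: (xgetI x xy).
have JN (G : homeo X X) x : ~ S x -> xget x (first_return G S x) = x.
  by move=> nS; apply: xgetPN => y [].
have Jc G : clopen S ->
    (forall x, S x -> exists2 r, (0 < r)%N & S (iter r (homeo_fun G) x)) ->
    continuous (fun x => xget x (first_return (homeo_fun G) S x)).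
  move=> cS ret x; have [Sx|nS] := pselect (S x).
    have [r [_ _ _ nr]] := first_return_near cS (JP _ ret _ Sx).
    apply: (@near_eq_continuous _ _ _ (iter r G)).
      apply: filterS nr => z zr; apply: (first_return_uniq _ zr).
      by apply: JP => //; case: zr.
    exact/iter_cts/homeo_cts.
  apply: (@near_eq_continuous _ _ _ id); last exact: cvg_id.
  have : \forall z \near x, (~` S) z.
    by apply: near_open => //; apply: closed_openC; case: cS.
  by apply: filterS => z; exact: JN.
have JK (G : homeo X X) :
    (forall x, S x -> exists2 r, (0 < r)%N & S (iter r G x)) ->
    (forall x, S x -> exists2 r, (0 < r)%N & S (iter r (inv_homeo G) x)) ->
    cancel (fun x => xget x (first_return G S x))
           (fun x => xget x (first_return (inv_homeo G) S x)).
  move=> ret reti x; have [Sx|nS] := pselect (S x); last by rewrite !JN.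
  have := JP _ ret x Sx; set y := xget x _ => xy.
  apply: (first_return_uniq _ (first_return_inv xy)).
  by apply: JP => //; case: xy.
move=> cS ret reti.
exists (Homeo (JK F ret reti) (JK (inv_homeo F) reti ret) (Jc F cS ret)
  (Jc (inv_homeo F) cS reti)); split=> x Sx /=; [exact: JP|exact: JN].
Qed.

End returns.

(** * Boyle's theorem: orbit equivalence with a continuous cocycle *)

(** [psi] and [psi'] are total maps that carry meaning only on [P], where they are mutually
    inverse. *)
Definition conjugate_on {X : topologicalType} (h J : homeo X X) (P : set X) :=
  exists psi psi' : X -> X,
  [/\ forall x, P x -> P (psi x) /\ P (psi' x),
      forall x, P x -> psi' (psi x) = x /\ psi (psi' x) = x,
      forall x, P x -> {for x, continuous psi} /\ {for x, continuous psi'}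
    & forall x, P x -> psi (h x) = J (psi x)].

Section orbit_equivalence.
Context {X : topologicalType} (h : homeo X X) (P : set X).
Local Open Scope ring_scope.

Section oriented.
Context (J : homeo X X) (f : X -> int -> int) (B K : nat).
Context (PJ : forall x, P x -> P (J x))
  (PJi : forall x, P x -> P (homeo_inv J x)) (Ph : forall x, P x -> P (h x))
  (Phi : forall x, P x -> P (homeo_inv h x))
  (infJ : forall x, P x -> infinite_set (zorbit J x))
  (infh : forall x, P x -> infinite_set (zorbit h x))
  (fE : forall x n, P x -> zpow h n x = zpow J (f x n) x)
  (f_loc : forall x n, P x -> \forall y \near x, f y n = f x n)
  (orb : forall x, P x -> zorbit h x = zorbit J x).

Lemma cocycleD x n m : P x -> f x (m + n) = f (zpow h n x) m + f x n.
Proof.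
move=> Px; have Phx : P (zpow h n x) by exact: invariant_zpow.
by apply: (zpow_inj (infJ Px)); rewrite -fE // !zpowD -fE // -fE.
Qed.

Lemma cocycle_inj x n m : P x -> f x n = f x m -> n = m.
Proof. by move=> Px e; apply: (zpow_inj (infh Px)); rewrite !fE // e. Qed.

Lemma cocycle_surj x k : P x -> exists n, f x n = k.
Proof.
move=> Px; have : zorbit h x (zpow J k x) by rewrite orb //; exact: zorbit_zpow.
move=> [n _ e]; exists n; apply: (zpow_inj (infJ Px)).
by rewrite -fE.
Qed.

Context (f1B : forall x, P x -> (`|f x 1| <= B)%N)
  (f_pos : forall x (n : int), P x -> K%:Z < n -> B%:Z < f x n)
  (f_neg : forall x (n : int), P x -> n < - K%:Z -> f x n < - B%:Z).

Let N := K.+1.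

(** The window is [-N <= n < N]. For [|e| <= B] the comparison [f x n < e] is already decided
    outside it: true to the left, false to the right. *)
Definition below_count x (e : int) : nat :=
  (\sum_(i < N + N) (f x (i%:Z - N%:Z) < e)%R)%N.

(** Raising the threshold by one adds the indices with [f x n = e]. Bijectivity of [f x] gives
    exactly one, and it satisfies [|n| <= K < N]. *)
Lemma below_countS x e : P x -> (`|e| <= B)%N ->
  below_count x (e + 1) = (below_count x e).+1.
Proof.
move=> Px eB; rewrite /below_count.
rewrite (eq_bigr (fun i : 'I_(N + N) =>
  nat_of_bool (f x (i%:Z - N%:Z) < e)%R +
  nat_of_bool (f x (i%:Z - N%:Z) == e)%R)%N); last first.
  by move=> i _; rewrite ltzD1; case: ltgtP.
rewrite big_split /= -addn1; congr (_ + _)%N.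
have [n fn] := cocycle_surj e Px.
have nK : `|n| <= K%:Z.
  rewrite leNgt; apply/negP => Kn.
  have [n0|n0] := leP 0 n.
    by have := @f_pos x n Px; lia.
  by have := @f_neg x n Px; lia.
have iN : (absz (n + N%:Z)%R < N + N)%N by rewrite /N; lia.
rewrite (bigD1 (Ordinal iN)) //= big1 ?addn0.
  have -> : (absz (n + N%:Z))%:Z - N%:Z = n by rewrite /N; lia.
  by rewrite fn eqxx.
move=> i iNn; apply/eqP; rewrite eqb0; apply: contra iNn => /eqP fi.
have e1 := cocycle_inj Px (etrans fi (esym fn)).
by apply/eqP/val_inj => /=; lia.
Qed.

Lemma below_countE x e : P x -> (`|e| <= B)%N ->
  (below_count x e)%:Z = (below_count x 0)%:Z + e.
Proof.
move=> Px; elim: e => [|e IH|e IH] eB; first by rewrite addr0.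
  by rewrite -addn1 PoszD below_countS //; lia.
have := @below_countS x (- e.+1%:Z) Px eB.
have -> : - e.+1%:Z + 1 = - e%:Z by lia.
by have := IH; lia.
Qed.

(** By the cocycle identity, threshold [0] at [h x] becomes threshold [f x 1] at [x] on the window
    moved by one. The end [-N] that drops out counts, the end [N] that comes in does not. *)
Lemma below_count_shift x : P x ->
  (below_count (h x) 0).+1 = below_count x (f x 1).
Proof.
move=> Px; pose G i : nat := f x (i%:Z - N%:Z) < f x 1.
rewrite /below_count (eq_bigr (fun i : 'I_(N + N) => G i.+1)); last first.
  move=> i _; rewrite /G.
  have -> : i.+1%:Z - N%:Z = (i%:Z - N%:Z) + 1 by lia.
  by rewrite (cocycleD 1 _ Px) /=; lia.
have : (\sum_(i < (N + N).+1) G i = G 0 + \sum_(i < N + N) G i.+1)%N.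
  by rewrite big_ord_recl.
rewrite big_ord_recr /=.
have -> : G 0%N = 1%N.
  have := @f_neg x (- N%:Z) Px; have := f1B Px; rewrite /G sub0r /N.
  by case: (ltP (f x (- K.+1%:Z)) (f x 1)) => //; lia.
have -> : G (N + N)%N = 0%N.
  have := @f_pos x N Px; have := f1B Px; rewrite /G PoszD addrK /N.
  by case: (ltP (f x (K.+1%:Z)) (f x 1)) => //; lia.
by rewrite addn0 add1n => ->.
Qed.

(* With [S x = {f x n : n >= 0}], the integer [a x] below is
   [#(S x \ nat) - #(nat \ S x)], counted in the window [-N,
     N).  Since [S (h x)]
   is [S x] without [0], shifted by [- f x 1], one gets
   [a (h x) = a x - 1 + f x 1], i.e. [psi (h x) = J (psi x)]. *)
Lemma oriented_conjugate : conjugate_on h J P.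
Proof.
pose a x : int := (below_count x 0)%:Z - N%:Z.
pose psi x := zpow J (- a x) x; pose psi' x := zpow h (a x) x.
have a_loc x : P x -> \forall y \near x, a y = a x.
  move=> Px.
  have := @near_forall_lt _ (fun i y => f y (i%:Z - N%:Z) = f x (i%:Z - N%:Z))
    (N + N) x (fun i _ => f_loc _ Px).
  apply: filterS => y fy; rewrite /a /below_count.
  by congr (_%:Z - _); apply: eq_bigr => i _; rewrite fy.
have Ppsi x : P x -> P (psi x) by move=> Px; exact: invariant_zpow.
have Ppsi' x : P x -> P (psi' x) by move=> Px; exact: invariant_zpow.
have psih x : P x -> psi (h x) = J (psi x).
  move=> Px; rewrite /psi -zpowS (_ : h x = zpow J (f x 1) x); last first.
    by rewrite -fE.
  rewrite -zpowD -fE //; congr (zpow _ _ _); rewrite /a.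
  have := below_count_shift Px; have := below_countE Px (f1B Px).
  by rewrite /=; lia.
have psiz n x : P x -> psi (zpow h n x) = zpow J n (psi x).
  move=> Px; elim: n => [//|n IH|n IH].
    by rewrite -addn1 PoszD !zpowS psih ?IH //; exact: invariant_zpow.
  apply: (can_inj (homeo_funK J)); rewrite -psih; last exact: invariant_zpow.
  rewrite -!zpowS; have -> : - n.+1%:Z + 1 = - n%:Z by lia.
  exact: IH.
(* Intertwining turns [psi (psi' x)] into [J^(a x)] applied to [psi x = J^(- a x) x]. *)
have psiK' x : P x -> psi (psi' x) = x.
  by move=> Px; rewrite psiz // zpowKN.
(* Equal images put [x] and [y] in one [J]-orbit, hence in one [h]-orbit, say [y = h^n x]; then
   [J^n] fixes [psi x] and [n = 0]. *)
have psi_inj x y : P x -> P y -> psi x = psi y -> x = y.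
  move=> Px Py e.
  have : zorbit h x y.
    rewrite orb // (zorbit_eq (zorbit_zpow J (- a x) x)).
    by rewrite -[zpow _ _ _]/(psi x) e -(zorbit_eq (zorbit_zpow J (- a y) y));
      exact: zorbit_refl.
  move=> [n _ yE]; move: e; rewrite -yE psiz // => e.
  have n0 : 0 = n by apply: (zpow_inj (infJ (Ppsi _ Px))); exact: e.
  by rewrite -n0.
exists psi, psi'; split => // x Px.
- by split; [exact: Ppsi|exact: Ppsi'].
- split; last exact: psiK'.
  by apply: psi_inj; rewrite ?psiK' //; [apply/Ppsi'/Ppsi|exact: Ppsi].
- split.
    apply: (@near_eq_continuous _ _ _ (zpow J (- a x))); last exact: zpow_cts.
    by apply: filterS (a_loc x Px) => y ay; rewrite /psi ay.
  apply: (@near_eq_continuous _ _ _ (zpow h (a x))); last exact: zpow_cts.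
  by apply: filterS (a_loc x Px) => y ay; rewrite /psi' ay.
Qed.

End oriented.

Lemma orbit_cocycle (J : homeo X X) : open P ->
  (forall x, P x -> P (h x)) -> (forall x, P x -> P (homeo_inv h x)) ->
  (forall x, P x -> infinite_set (zorbit J x)) ->
  (forall x, P x -> local_power J h x) ->
  exists f : X -> int -> int,
    (forall x n, P x -> zpow h n x = zpow J (f x n) x) /\
    (forall x n, P x -> \forall y \near x, f y n = f x n).
Proof.
move=> openP Ph Phi infJ lh.
pose f x n := xget (0 : int) [set m | zpow h n x = zpow J m x].
have lhz x n : P x -> local_power J (zpow h n) x by exact: local_power_zpow.
have fE x n : P x -> zpow h n x = zpow J (f x n) x.
  move=> Px; have [m nm] := lhz x n Px.
  exact: (xgetI (0 : int) (nbhs_singleton nm : [set m | _] m)).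
exists f; split=> // x n Px; have [m nm] := lhz x n Px.
have fx y : P y -> zpow h n y = zpow J m y -> f y n = m.
  by move=> Py ym; apply: (zpow_inj (infJ y Py)); rewrite -ym fE.
have xm := nbhs_singleton nm.
apply: filterS2 (near_open openP Px) nm => y Py ym.
by rewrite (fx y) // (fx x).
Qed.

(** Each [f x] is a bijection of the integers with bounded steps, so it has a constant sign near
    either end, and the two signs differ. The sign at the right end is locally constant and
    [h]-invariant, so minimality makes it the same all over [P]; it decides between [J] and its
    inverse. *)
Theorem minimal_orbit_equivalence (J : homeo X X) : clopen P -> compact P ->
  minimal_on h P ->
  (forall x, P x -> P (J x)) -> (forall x, P x -> P (homeo_inv J x)) ->
  (forall x, P x -> infinite_set (zorbit h x)) ->
  (forall x, P x -> local_power J h x) ->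
  (forall x, P x -> zorbit J x `<=` zorbit h x) ->
  conjugate_on h J P \/ conjugate_on h (inv_homeo J) P.
Proof.
move=> [openP closedP] compactP [Ph Phi minP] PJ PJi infh lh Jh.
have orb x : P x -> zorbit h x = zorbit J x.
  move=> Px; apply/seteqP; split; last exact: Jh.
  move=> _ [n _ <-]; have [m nm] := local_power_zpow n Ph Phi lh Px.
  by exists m => //; rewrite (nbhs_singleton nm).
have infJ x : P x -> infinite_set (zorbit J x).
  by move=> Px; rewrite -orb //; exact: infh.
have [f [fE f_loc]] := orbit_cocycle openP Ph Phi infJ lh.
have fD x (n m : int) : P x -> f x (m + n) = f (zpow h n x) m + f x n.
  exact: (cocycleD (J := J)).
have f_inj x (n m : int) : P x -> f x n = f x m ->
  n = m by exact: (cocycle_inj (J := J)).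
have f_surj x (k : int) : P x ->
  exists n, f x n = k by exact: (cocycle_surj (J := J)).
have [B fB] : exists B, forall x, P x -> (`|f x 1%R| <= B)%N.
  apply: (@compact_bound _ P (fun x B => `|f x 1%R| <= B)%N) => //.
    by move=> x k l kl fk; exact: leq_trans fk kl.
  move=> x Px; exists `|f x 1|%N.
  by apply: filterS (f_loc x 1 Px) => y ->.
have f_step x (n : int) : P x -> `|f x (n + 1) - f x n| <= B%:Z.
  move=> Px; rewrite [n + 1]addrC fD // addrK.
  have /fB : P (zpow h n x) by exact: invariant_zpow.
  by lia.
(* [K] bounds the preimages of [[-B, B]] uniformly in [x]. At one point it is found by adding the
   preimages of [b + 1] and [- (b + 1)] in turn; nearby points share the finitely many values of [f]
   involved. *)
have [K fK] : exists K, forall x, P x -> forall j : int, `|j| <= B%:Z ->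
    exists2 n : int, `|n| <= K%:Z & f x n = j.
  apply: (@compact_bound _ P (fun x K => forall j : int, `|j| <= B%:Z ->
    exists2 n : int, `|n| <= K%:Z & f x n = j)) => //.
    by move=> x k l kl fk j /fk[n nk fn]; exists n => //; lia.
  move=> x Px; have /(_ B) [k kP] : forall b : nat, exists k : nat,
      forall j : int, `|j| <= b%:Z -> exists2 n : int, `|n| <= k%:Z & f x n = j.
    elim=> [|b [k kP]].
      have [n n0] := f_surj x 0 Px; exists `|n|%N => j j0; exists n;
        first by lia.
      by rewrite n0; lia.
    have [p fp] := f_surj x b.+1%:Z Px.
    have [q fq] := f_surj x (- b.+1%:Z) Px.
    exists (k + `|p| + `|q|)%N => j jb.
    have [jl|] := leP `|j| b%:Z.
      by have [n nk fn] := kP j jl; exists n => //; lia.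
    have [j0 bj|j0 bj] := leP 0 j.
      by exists p; [lia|rewrite fp; lia].
    by exists q; [lia|rewrite fq; lia].
  exists k.
  have := @near_forall_lt _ (fun i y => f y (i%:Z - k%:Z) = f x (i%:Z - k%:Z))
    (k + k).+1 x (fun i _ => f_loc _ _ Px).
  apply: filterS => y fy j /kP[n nk fn]; exists n => //.
  have := fy (`|(n + k%:Z)%R|)%N.
  have -> : (`|(n + k%:Z)%R|)%N%:Z - k%:Z = n by lia.
  by move=> ->; [exact: fn|lia].
have f_large x (n : int) : P x -> K%:Z < `|n| -> B%:Z < `|f x n|.
  move=> Px nK; rewrite ltNge; apply/negP => /(fK _ Px)[m mK fm].
  by have := f_inj _ _ _ Px fm; lia.
(* From [k] on, and symmetrically from [-k] down, values exceed [B] in absolute value while steps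
   are at most [B], so the sign cannot change. *)
pose k := K.+1%:Z.
have sgn_right x (i : nat) : P x -> (0 < f x (k + i%:Z)) = (0 < f x k).
  move=> Px; elim: i => [|i IH]; first by rewrite addr0.
  have := f_step x (k + i%:Z) Px; have := @f_large x (k + i%:Z) Px.
  have := @f_large x (k + i.+1%:Z) Px.
  have -> : k + i.+1%:Z = k + i%:Z + 1 by lia.
  by rewrite -IH /k => ? ? ?; apply/idP/idP; lia.
have sgn_left x (i : nat) : P x -> (0 < f x (- k - i%:Z)) = (0 < f x (- k)).
  move=> Px; elim: i => [|i IH]; first by rewrite subr0.
  have := f_step x (- k - i.+1%:Z) Px; have := @f_large x (- k - i%:Z) Px.
  have := @f_large x (- k - i.+1%:Z) Px.
  have -> : - k - i.+1%:Z + 1 = - k - i%:Z by lia.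
  by rewrite -IH /k => ? ? ?; apply/idP/idP; lia.
have f0 x : P x -> f x 0 = 0.
  by move=> Px; have := fD x 0 0 Px; rewrite addr0 /=; lia.
have f_growth x (n : int) : P x -> `|f x n| <= `|n| * B%:Z.
  move=> Px; elim: n => [|n IH|n IH]; first by rewrite f0.
    have -> : `|n.+1%:Z| = `|n%:Z| + 1 by lia.
    have -> : n.+1%:Z = n%:Z + 1 by lia.
    by have := f_step x n Px; rewrite mulrDl mul1r; lia.
  have := f_step x (- n.+1%:Z) Px.
  have -> : - n.+1%:Z + 1 = - n%:Z by lia.
  have -> : `|- n.+1%:Z| = `|- n%:Z| + 1 by lia.
  by rewrite mulrDl mul1r; lia.
(* Otherwise the cocycle would be bounded on one side, hence not onto. *)
have sgn_opp x : P x -> (0 < f x (- k)) = ~~ (0 < f x k).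
  move=> Px.
  have [pp nn] : (0 < f x k -> 0 < f x (- k) -> False) /\
      (f x k <= 0 -> f x (- k) <= 0 -> False).
    (* Linear growth bounds [f x] by [K * B] on [[-K, K]], so values of size [M] occur only on the
       two ends, where the sign is known. *)
    pose M := (K * B)%:Z + 1.
    have far (n : int) : (`|f x n| <= (K * B)%:Z) \/
        (0 < f x n) = (0 < f x k) \/ (0 < f x n) = (0 < f x (- k)).
      have [nK|nK] := leP `|n| K%:Z.
        by left; apply: le_trans (f_growth x n Px) _; rewrite PoszM; nia.
      right; have [n0|n0] := leP 0 n; [left|right].
        have -> : n = k + (`|(n - k)%R|%N)%:Z by rewrite /k; lia.
        exact: sgn_right.
      have -> : n = - k - (`|(n + k)%R|%N)%:Z by rewrite /k; lia.
      exact: sgn_left.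
    split=> [fp fn|fp fn].
      have [n fM] := f_surj x (- M) Px; have := far n.
      by rewrite fM /M fp fn; lia.
    have [n fM] := f_surj x M Px; have := far n.
    by rewrite fM /M; lia.
  by case: (ltP 0 (f x k)) pp nn => ? pp nn; case: ltP => // ?; exfalso; auto.
have f_pos x (n : int) : P x -> 0 < f x k -> (K%:Z < n -> B%:Z < f x n) /\
    (n < - K%:Z -> f x n < - B%:Z).
  move=> Px fk; split=> nK; have := @f_large x n Px.
    have := sgn_right x (`|(n - k)%R|)%N Px.
    have -> : k + (`|(n - k)%R|%N)%:Z = n by rewrite /k; lia.
    by rewrite fk; lia.
  have := sgn_left x (`|(n + k)%R|)%N Px; rewrite sgn_opp // fk.
  have -> : - k - (`|(n + k)%R|%N)%:Z = n by rewrite /k; lia.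
  by lia.
have f_neg x (n : int) : P x -> ~ 0 < f x k -> (K%:Z < n -> B%:Z < - f x n) /\
    (n < - K%:Z -> - f x n < - B%:Z).
  move=> Px /negP/negbTE fk; split=> nK; have := @f_large x n Px.
    have := sgn_right x (`|(n - k)%R|)%N Px.
    have -> : k + (`|(n - k)%R|%N)%:Z = n by rewrite /k; lia.
    by rewrite fk; lia.
  have := sgn_left x (`|(n + k)%R|)%N Px; rewrite sgn_opp // fk.
  have -> : - k - (`|(n + k)%R|%N)%:Z = n by rewrite /k; lia.
  by lia.
have [[x0 [Px0 x0k]]|npos] := pselect (exists x, P x /\ 0 < f x k).
  left; suff allpos x : P x -> 0 < f x k.
    apply: (@oriented_conjugate J f B K) => // x n Px.
      by apply: (f_pos x n Px _).1; exact: allpos.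
    by apply: (f_pos x n Px _).2; exact: allpos.
  (* [Q] is closed since [f] is locally constant, and invariant since
     [f (h y) k = f y (k + 1) - f y 1], where the first term exceeds [B] and the second does not. *)
  pose Q := [set x | P x /\ 0 < f x k].
  have cQ : closed Q.
    rewrite -openC openE => y nQ; have [Py|nPy] := pselect (P y).
      rewrite /interior; apply: filterS (f_loc y k Py) => z zk [Pz].
      by rewrite zk => fz; exact: nQ.
    by apply: filterS (near_open (closed_openC closedP) nPy) => z nPz [].
  suff PQ : P `<=` Q by move=> /PQ [].
  apply: minP => //; [by exists x0|by move=> y []|].
  move=> y [Py yk]; split; first exact: Ph.
  have := fD y 1 k Py; rewrite -[zpow h 1 y]/(h y).
  have := sgn_right y 1%N Py; rewrite yk -[Posz 1]/(1 : int) => yk1.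
  have := @f_large y (k + 1) Py; have := fB y Py.
  by rewrite /k in yk1 *; lia.
right; apply: (@oriented_conjugate (inv_homeo J) (fun x n => - f x n) B K) =>
  //.
- by move=> x Px; rewrite zorbit_inv; exact: infJ.
- by move=> x n Px; rewrite zpow_inv opprK fE.
- by move=> x n Px; apply: filterS (f_loc x n Px) => y ->.
- by move=> x Px; rewrite zorbit_inv orb.
- by move=> x Px; rewrite abszN; exact: fB.
- by move=> x n Px; apply: (f_neg x n Px _).1 => fx; apply: npos; exists x.
- by move=> x n Px; apply: (f_neg x n Px _).2 => fx; apply: npos; exists x.
Qed.

End orbit_equivalence.

(** * Invariant closed sets are clopen *)

Section minimal_systems.
Context {X : topologicalType}.
Implicit Types (g h : homeo X X) (K : set X).
Local Open Scope ring_scope.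

Lemma minimalE g : minimal g <-> [set: X] !=set0 /\ minimal_on g setT.
Proof.
split=> -[X0 gmin]; split=> //.
  split=> // K cK [x Kx] _ gK; apply: contrapT => nK.
  suff K0 : K = set0 by rewrite K0 in Kx.
  apply: gmin => //; last by move=> _ [y Ky <-]; exact: gK.
  by apply/eqP => KT; apply: nK; rewrite KT.
move=> K cK KT gK; have [//|/set0P K0] := eqVneq K set0.
case: gmin => _ _ /(_ K cK K0) TK; case/eqP: KT; apply/seteqP; split=> //.
by apply: TK => // x Kx; apply: gK; exists x.
Qed.

(** A finite orbit is closed in a Hausdorff space, so by minimality it would contain [A]. *)
Lemma minimal_on_aperiodic g (A : set X) x : hausdorff_space X ->
  infinite_set A -> minimal_on g A -> A x -> infinite_set (zorbit g x).
Proof.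
move=> hX infA [Ag Ai minA] Ax fin; apply: infA; apply: (sub_finite_set _ fin).
apply: minA.
- exact: (accessible_finite_set_closed.1 (hausdorff_accessible hX)) _ fin.
- by exists x; exact: zorbit_refl.
- by move=> _ [n _ <-]; exact: invariant_zpow.
- by move=> _ [n _ <-]; exists (n + 1) => //; rewrite zpowS.
Qed.

(* The sequence [u] meets every window [N, N + B], [N >= 0], so the translates
   of [K] by [g^-j], [j <= B], cover the forward orbit of [x],
     hence the space. *)
Lemma syndetic_interior g K B (u : nat -> int) x : closed K ->
  (forall n, K (zpow g (u n) x)) -> u 0%N = 0 ->
  (forall n, `|u n.+1 - u n| <= B%:Z) ->
    (forall M : nat, exists n, M%:Z < u n) ->
  (forall U, open U -> U !=set0 -> exists r, U (iter r g x)) ->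
  exists U, [/\ open U, U !=set0 & U `<=` K].
Proof.
move=> cK Ku u0 uB u_unbounded dense_x; apply: contrapT => noU.
have gc j := @iter_cts _ g j (@homeo_cts _ _ g).
have gic j := @iter_cts _ (inv_homeo g) j (@homeo_cts _ _ (inv_homeo g)).
(* If [K] has empty interior, so has the union of its translates by [g^-j], [j <= B]. The open set
   [V] avoiding them all is cut down one [j] at a time: were all of [g^j V] inside [K], then [K]
   would have interior. *)
have [V [oV V0 VK]] : exists V, [/\ open V, V !=set0 &
    forall j y, (j < B.+1)%N -> V y -> ~ K (iter j g y)].
  elim: B.+1 => [|b [V [oV [v Vv] VK]]].
    by exists setT; split=> //; [exact: openT|exists x].
  have [[y [Vy nKy]]|allK] := pselect (exists y, V y /\ ~ K (iter b g y)).
    exists (V `&` iter b g @^-1` (~` K)); split.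
    - apply: openI => //; apply: open_comp; last exact: closed_openC.
      by move=> z _; exact: gc.
    - by exists y.
    move=> j z; rewrite ltnS leq_eqVlt => /orP[/eqP->|jb] [Vz nK] //.
    exact: VK.
  case: noU; exists (iter b (inv_homeo g) @^-1` V); split.
  - by apply: open_comp => // z _; exact: gic.
  - by exists (iter b g v); rewrite /= iter_inv.
  move=> z Vz; have -> : z = iter b g (iter b (inv_homeo g) z).
    by rewrite (iter_inv (inv_homeo g)).
  by apply: contrapT => nK; apply: allK; exists (iter b (inv_homeo g) z).
have [r Vr] := dense_x V oV V0.
have ex : exists n, r%:Z <= u n.
  by have [n nr] := u_unbounded r; exists n; exact: ltW.
have [n rn nmin] := ex_minnP ex.
(* The first [u n] at or above [r] overshoots by at most one step [B]; if [n = 0], then [u 0 = 0]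
   forces [r = 0]. *)
have [j jB un] : exists2 j, (j <= B)%N & u n = (j + r)%N%:Z.
  case: n rn nmin => [|n] rn nmin; first by exists 0%N => //; lia.
  have := uB n; have : ~~ (r%:Z <= u n).
    by apply/negP => /nmin; rewrite ltnn.
  by move=> *; exists (absz (u n.+1 - r%:Z)); lia.
by apply: (VK j _ _ Vr) => //; rewrite -iterD; have := Ku n; rewrite un.
Qed.

End minimal_systems.

(** * Invariant sets and orbit closures of an aperiodic full group element *)

Section full_group_structure.
Context {X : topologicalType} (g h : homeo X X).
Context (compactX : compact [set: X]) (hausdorffX : hausdorff_space X)
  (min_g : minimal_on g setT) (aper_h : aperiodic h)
  (gh : full_group g h).
Implicit Types (K : set X) (x y : X).
Local Open Scope ring_scope.

(** The exponents [u n] of the forward [h]-orbit are distinct, hence unbounded by the pigeonhole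
    principle. If they are unbounded above, [syndetic_interior] applies to [g]; otherwise it applies
    to the inverse of [g] and [- u]. *)
Lemma invariant_interior K x : closed K -> K x -> (forall y, K y -> K (h y)) ->
  exists U, [/\ open U, U !=set0 & U `<=` K].
Proof.
move=> cK Kx hK.
have infX : infinite_set [set: X].
  by move=> fX; apply: (@aper_h x); exact: sub_finite_set fX.
have aper_g y : infinite_set (zorbit g y).
  exact: (minimal_on_aperiodic hausdorffX infX min_g).
have [//|//|//|y _|f [fE f_loc]] := @orbit_cocycle X h setT g openT.
  exact: (full_group_local_power _ gh).
pose u n := f x n%:Z.
have [B fB] : exists B, forall y, [set: X] y -> (`|f y 1%R| <= B)%N.
  apply: (@compact_bound _ setT (fun y B => `|f y 1%R| <= B)%N) => //.
    by move=> y k l kl fk; exact: leq_trans fk kl.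
  move=> y Py; exists `|f y 1|%N.
  by apply: filterS (f_loc y 1 Py) => z ->.
have uB n : `|u n.+1 - u n| <= B%:Z.
  have fD : f x (1 + n%:Z) = f (zpow h n x) 1 + f x n%:Z.
    by apply: (@cocycleD _ h setT g f).
  have -> : u n.+1 = f x (1 + n%:Z) by rewrite /u -intS.
  by rewrite fD addrK; have := fB (zpow h n x) I; lia.
have u0 : u 0%N = 0.
  by apply: (zpow_inj (aper_g x)); rewrite -fE.
have u_inj : injective u.
  move=> n m e; apply/eqP; rewrite -eqz_nat; apply/eqP.
  by apply: (zpow_inj (@aper_h x)); rewrite !fE // -/(u n) e.
have Ku n : K (zpow g (u n) x).
  by rewrite -fE //=; elim: n => //= n IH; exact: hK.
have u_unbounded M : exists n, M%:Z < `|u n|.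
  apply: contrapT => nM.
  have uM n : `|u n| <= M%:Z.
    by rewrite leNgt; apply/negP => Mn; apply: nM; exists n.
  have lt n : (absz (u n + M%:Z)%R < (M + M).+1)%N by have := uM n; lia.
  pose v (i : 'I_(M + M).+2) : 'I_(M + M).+1 := Ordinal (lt i).
  have vinj : injective v.
    move=> i j /(congr1 val) /= e; apply/val_inj; apply: (u_inj i j).
    by have := uM i; have := uM j; lia.
  by have := leq_card v vinj; rewrite !card_ord ltnn.
have [up|] := pselect (forall M : nat, exists n, M%:Z < u n).
  apply: (syndetic_interior cK Ku u0 uB up) => U oU U0.
  by have [|r _ Ur] := minimal_on_enter min_g closedT oU _ (I : setT x);
    [rewrite setTI|exists r].
move/existsNP => [M0 /forallNP uM0].
apply: (@syndetic_interior X (inv_homeo g) K B (fun n => - u n) x) => //.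
- by move=> n; rewrite zpow_inv opprK.
- by rewrite u0.
- by move=> n; have := uB n; lia.
- move=> M; have [n un] := u_unbounded (M0 + M)%N.
  by exists n; have := uM0 n; lia.
move=> U oU U0.
by have [|r _ Ur] := minimal_on_enter_back min_g closedT compactX oU _
  (I : setT x); [rewrite setTI|exists r].
Qed.

(** Invariance under the inverse makes the boundary [K \ K°] forward invariant. If nonempty it would
    contain an open set, which would lie in [K°]. *)
Lemma invariant_clopen K : closed K -> (forall y, K y -> K (h y)) ->
  (forall y, K y -> K (homeo_inv h y)) -> clopen K.
Proof.
move=> cK hK hiK; split=> //.
have intP (f : homeo X X) : (forall y, K y -> K (f y)) ->
    forall y, K° y -> K° (f y).
  move=> fK y Ky; have : nbhs (homeo_inv f (f y)) K by rewrite homeo_funK.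
  move=> /(near_fun _ _ _ (@homeo_inv_cts _ _ f (f y))) iK.
  by apply: filterS iK => z /= /fK; rewrite homeo_invK.
suff -> : K = K° by exact: open_interior.
apply/seteqP; split; last exact: interior_subset.
move=> x Kx; apply: contrapT => nx.
have [|||U [oU [y Uy] UK]] := @invariant_interior (K `\` K°) x.
- by rewrite setDE; apply: closedI => //; exact/open_closedC/open_interior.
- by [].
- move=> y [Ky nKy]; split; first exact: hK.
  by move=> /(intP (inv_homeo h) hiK) /=; rewrite homeo_funK.
have [_ nKy] := UK y Uy; apply: nKy.
rewrite /interior; apply: filterS (near_open oU Uy) => z /UK[].
by [].
Qed.

Lemma orbit_closure_invariant x :
  (forall y, closure (zorbit h x) y -> closure (zorbit h x) (h y)) /\
  (forall y, closure (zorbit h x) y -> closure (zorbit h x) (homeo_inv h y)).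
Proof.
split; first by apply: closure_invariant => _ [n _ <-]; exists (n + 1) => //;
  rewrite zpowS.
apply: (@closure_invariant _ (inv_homeo h)) => _ [n _ <-].
exists (n - 1) => //; apply: (can_inj (homeo_funK h)).
by rewrite -zpowS subrK homeo_invK.
Qed.

Lemma orbit_closure_clopen x : clopen (closure (zorbit h x)).
Proof.
have [hC hiC] := orbit_closure_invariant x.
by apply: invariant_clopen => //; exact: closed_closure.
Qed.

(** The closure of the orbit of [y] is an open neighbourhood of [y], so the orbit of [x] meets it;
    being invariant, it contains [x]. *)
Lemma orbit_closure_eq x y :
  closure (zorbit h x) y -> closure (zorbit h y) = closure (zorbit h x).
Proof.
have sub z t : closure (zorbit h z) t ->
  closure (zorbit h t) `<=` closure (zorbit h z).
  move=> zt; have [hC hiC] := orbit_closure_invariant z.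
  rewrite [X in _ `<=` X](closure_id _).1; last exact: closed_closure.
  by apply: closureS => _ [n _ <-]; exact: (invariant_zpow n hC hiC zt).
move=> xy; apply/seteqP; split; apply: sub => //.
have [oD _] := orbit_closure_clopen y.
have [_ [[n _ <-] yn]] :=
  xy _ (open_nbhs_nbhs (conj oD (subset_closure (zorbit_refl h y)))).
rewrite -(zpowNK h n x).
by have [hC hiC] := orbit_closure_invariant y;
  exact: (invariant_zpow (- n) hC hiC yn).
Qed.

(** Density concerns two-sided orbits, minimality forward invariant sets. For such [K], the open set
    [U = C \ K] is backward invariant and met by every orbit in [C]; compactness gives one [k] with
    [h^-k C] inside [U], contradicted by [h^k x0]. *)
Lemma orbit_closure_minimal x : minimal_on h (closure (zorbit h x)).
Proof.
set C := closure _; have [hC hiC] : _ /\ _ := orbit_closure_invariant x.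
have [oC cC] := orbit_closure_clopen x.
split=> // K cK [x0 Kx0] KC hK;
  apply: contrapT => /existsNP[p /not_implyP[Cp nKp]].
pose U := C `&` ~` K.
have oU : open U by apply: openI => //; exact: closed_openC.
have Uback z : U (h z) -> U z.
  move=> [Chz nKhz]; split; last by move/hK.
  by rewrite -(homeo_funK h z); exact: hiC.
have UbackN k z : U (iter k h z) -> U z by elim: k => //= k IH /Uback.
have [k Uk] : exists k, forall y, C y -> U (iter k (inv_homeo h) y).
  apply: (@compact_bound _ C (fun y k => U (iter k (inv_homeo h) y))).
  - by apply: (subclosed_compact cC compactX).
  - move=> y k l kl Uk; apply: (UbackN (l - k)%N).
    have -> : iter (l - k) h (iter l (inv_homeo h) y) = iter k (inv_homeo h) y.
      by rewrite (iter_inv_sub (inv_homeo h)) ?leq_subr // subKn.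
    exact: Uk.
  move=> y Cy; have [k Uk] : exists k, U (iter k (inv_homeo h) y).
    have : closure (zorbit h y) p by rewrite (orbit_closure_eq Cy).
    move=> /(_ U (open_nbhs_nbhs (conj oU (conj Cp nKp))))[_ [[n _ <-]]].
    case: n => n Un; last by exists n.+1.
    by exists 0%N; exact: UbackN Un.
  exists k; apply: near_preimage => //.
  exact: (@iter_cts _ (inv_homeo h) k (@homeo_cts _ _ (inv_homeo h))).
have Ch : C (iter k h x0) by elim: k {Uk} => /= [|k IH]; [exact: KC|exact: hC].
by have := Uk _ Ch; rewrite iter_inv => -[].
Qed.

End full_group_structure.

(** * Restriction to a clopen subset *)

Section subtypes.
Context {X : topologicalType}.
Implicit Types A : set X.

Lemma open_set_type A (U : set A) :
  open U <-> exists2 V : set X, open V & set_val @^-1` V = U.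
Proof. by []. Qed.

Lemma set_val_inj A : injective (set_val : A -> X).
Proof. by move=> x y; rewrite set_valE => /val_inj. Qed.

Definition in_set_type A x (Ax : A x) : A := SigSub (mem_set Ax).

Lemma set_val_in A x (Ax : A x) : set_val (in_set_type Ax) = x.
Proof. by rewrite set_valE. Qed.

Lemma set_val_preimage A (V : set X) :
  set_val @` (set_val @^-1` V : set A) = A `&` V.
Proof.
apply/seteqP; split=> [_ [x Vx <-]|x [Ax Vx]]; first by split=> //;
  exact: set_valP.
by exists (in_set_type Ax); rewrite /= set_val_in.
Qed.

Lemma set_val_continuous A : continuous (set_val : A -> X).
Proof. exact: initial_continuous. Qed.

Lemma open_set_val A (U : set A) : open A -> open U -> open (set_val @` U).
Proof.
by move=> oA /open_set_type[V oV <-]; rewrite set_val_preimage; exact: openI.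
Qed.

Lemma closed_set_val A (U : set A) :
  closed A -> closed U -> closed (set_val @` U).
Proof.
move=> cA; rewrite -openC => /open_set_type[V oV VU].
have -> : U = set_val @^-1` (~` V) by rewrite -preimage_setC VU setCK.
by rewrite set_val_preimage; apply: closedI => //; exact: open_closedC.
Qed.

Lemma clopen_set_val A (U : set A) : clopen A -> clopen U ->
  clopen (set_val @` U).
Proof.
by move=> [oA cA] [oU cU]; split; [exact: open_set_val|exact: closed_set_val].
Qed.

Lemma compact_set_type A : compact A -> compact [set: A].
Proof.
move=> cA F FF _.
have [|p [Ap clp]] := cA (fmap (set_val : A -> X) F) _.
  by rewrite /fmap /=; apply: filterS filterT => x _; exact: set_valP.
exists (in_set_type Ap); split=> // U V FU.
rewrite nbhsE => -[W [/open_set_type[W' oW' <-] Wp] WV].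
have FU' : fmap (set_val : A -> X) F (set_val @` U).
  by rewrite /fmap /=; apply: filterS FU => x Ux; exists x.
have W'p : nbhs p W'.
  by apply: open_nbhs_nbhs; split=> //; move: Wp; rewrite /= set_val_in.
have [_ [[x Ux <-] W'x]] := clp _ _ FU' W'p.
by exists x; split=> //; exact: WV.
Qed.

Lemma hausdorff_set_type A : hausdorff_space X -> hausdorff_space A.
Proof.
move=> hX x y cl; apply: set_val_inj; apply: hX => U V Ux Vy.
have [z [Uz Vz]] := cl _ _ (set_val_continuous Ux) (set_val_continuous Vy).
by exists (set_val z).
Qed.

Lemma infinite_set_type A : infinite_set [set: A] <-> infinite_set A.
Proof.
split=> infA finA; apply: infA.
  rewrite (_ : setT = set_val @^-1` A).
    by apply: finite_preimage => // x y _ _; exact: set_val_inj.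
  by apply/seteqP; split=> x //= _; exact: set_valP.
have -> : A = set_val @` [set: A].
  apply/seteqP; split=> [x Ax|_ [x _ <-]]; last exact: set_valP.
  by exists (in_set_type Ax); rewrite ?set_val_in.
exact: finite_image.
Qed.

Lemma set_val_restr (h : homeo X X) A (hA : h @` A = A) (x : A) :
  set_val (restr h hA x) = h (set_val x).
Proof. by []. Qed.

Lemma image_invariant (h : homeo X X) A : h @` A = A <->
  (forall x, A x -> A (h x)) /\ (forall x, A x -> A (homeo_inv h x)).
Proof.
split=> [hA|[hA hiA]].
  split=> [x Ax|x]; first by rewrite -hA; exists x.
  by rewrite -{1}hA => -[y Ay <-]; rewrite homeo_funK.
apply/seteqP; split=> [_ [x Ax <-]|x Ax]; first exact: hA.
by exists (homeo_inv h x); [exact: hiA|rewrite homeo_invK].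
Qed.

Lemma minimal_restr (h : homeo X X) A (hA : h @` A = A) : closed A ->
  minimal (restr h hA) <-> A !=set0 /\ minimal_on h A.
Proof.
move=> cA; have [hA1 hA2] := (image_invariant h A).1 hA.
split=> [[[a _] minA]|[[a Aa] [_ _ minA]]].
  split; first by exists (set_val a); exact: set_valP.
  split=> // K cK [k Kk] KA hK x Ax; apply: contrapT => nKx.
  have K0 : set_val @^-1` K = (set0 : set A).
    apply: minA; first by apply: preimage_closed => // y _;
      exact: set_val_continuous.
      apply/eqP => KT; apply: nKx.
      have : [set: A] (in_set_type Ax) by [].
      by rewrite -KT /= set_val_in.
    by move=> _ [y Ky <-]; exact: hK.
  have : (set_val @^-1` K) (in_set_type (KA _ Kk)) by rewrite /= set_val_in.
  by rewrite K0.
split; first by exists (in_set_type Aa).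
move=> K cK KT hK; have [//|/set0P[k Kk]] := eqVneq K set0.
case/eqP: KT; apply/seteqP; split=> // x _.
have : A `<=` set_val @` K.
  apply: minA.
  - exact: closed_set_val.
  - by exists (set_val k); exists k.
  - by move=> _ [y _ <-]; exact: set_valP.
  - move=> _ [y Ky <-]; exists (restr h hA y) => //.
    by apply: hK; exists y.
by move=> /(_ _ (set_valP x))[y Ky /set_val_inj <-].
Qed.

Lemma compact_minimal_restr (h : homeo X X) A (hA : h @` A = A) :
  compact [set: X] -> hausdorff_space X -> closed A ->
  compact_minimal (restr h hA) <->
  [/\ infinite_set A, A !=set0 & minimal_on h A].
Proof.
move=> cX hX cA; split.
  by move=> [/infinite_set_type infA _ _ /(minimal_restr hA cA)[]].
move=> [infA A0 mA]; split.
- exact/infinite_set_type.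
- by apply: compact_set_type; exact: subclosed_compact cX _.
- exact: hausdorff_set_type.
- exact/minimal_restr.
Qed.

End subtypes.

(** * Kakutani equivalence inside one space *)

Section kakutani.
Context {X : topologicalType}.
Implicit Types (F G : homeo X X) (A B Y Z : set X).

(** A backward orbit starting in [K] would enter the complement of [K] by
    [minimal_on_enter_back]. *)
Lemma minimal_on_inv F A : closed A -> compact A ->
  minimal_on F A -> minimal_on (inv_homeo F) A.
Proof.
move=> cA coA mF; have [AF Ai minA] := mF; split=> // K cK [x Kx] KA iK.
apply: contrapT => /existsNP[p /not_implyP[Ap nKp]].
have [|r _ []] := minimal_on_enter_back mF cA coA (closed_openC cK) _ (KA x Kx).
  by exists p.
by elim: r => //= r; exact: iK.
Qed.

(** This keeps [induced] off its dummy value on clopen subsets of [A]. *)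
Definition recurrent_on F A := forall Y, clopen Y -> Y `<=` A ->
  forall x, Y x -> exists2 r, (0 < r)%N & Y (iter r F x).

Lemma minimal_on_recurrent F A : closed A -> minimal_on F A -> recurrent_on F A.
Proof.
move=> cA mF Y [oY _] YA x Yx; apply: (minimal_on_enter mF cA oY _ (YA x Yx)).
by exists x; split=> //; exact: YA.
Qed.

(** Kakutani equivalence of the restrictions to [A] and [B], with subsets and maps of the ambient
    [X] and the return relation in place of [induced]. *)
Definition kakutani_on F G A B := exists Y Z (k k' : X -> X),
  [/\ [/\ Y !=set0, clopen Y, Y `<=` A, clopen Z & Z `<=` B],
      forall y, Y y -> Z (k y) /\ k' (k y) = y,
      forall z, Z z -> Y (k' z) /\ k (k' z) = z,
      (forall y, Y y -> {for y, continuous k}) /\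
      (forall z, Z z -> {for z, continuous k'})
    & forall y y', first_return F Y y y' -> first_return G Z (k y) (k y')].

Lemma induced_first_return (T : topologicalType) (a : homeo T T) (Y : set T)
    (y : Y) : (exists2 r, (0 < r)%N & Y (iter r a (set_val y))) ->
  first_return a Y (set_val y) (set_val (induced a y)).
Proof.
move=> [r r0 Yr]; split; [exact: set_valP|exact: set_valP|].
exists (return_time a Y (set_val y)).
have -> : set_val (induced a y) = iter (return_time a Y (set_val y)) a (set_val
  y).
  by [].
rewrite /return_time; case: pselect => [ex|[]]; last first.
  by exists r; rewrite /returns r0; apply/asboolP.
case: ex_minnP => t /andP[t0 _] tmin; split=> // s /andP[s0 st] Ys.
by have := tmin s; rewrite leqNgt st /returns s0 => /(_ (asboolT Ys)).
Qed.

Lemma image_set_val A (U : set A) (x : A) : (set_val @` U) (set_val x) <-> U x.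
Proof. by split=> [[y Uy /set_val_inj <-]|Ux] //; exists x. Qed.

Lemma first_return_set_val A F (a : homeo A A) (Y : set A) (u v : A) :
  (forall x, set_val (a x) = F (set_val x)) ->
  first_return a Y u v <-> first_return F (set_val @` Y) (set_val u) (set_val
    v).
Proof.
move=> aF; have aFk k x : set_val (iter k a x) = iter k F (set_val x).
  by elim: k => //= k <-.
split=> [[Yu Yv [r [r0 rv rY]]]|[/image_set_val Yu /image_set_val Yv [r [r0 rv
  rY]]]].
  split; [exact/image_set_val|exact/image_set_val|exists r; split=> //].
    by rewrite -aFk rv.
  by move=> s /rY; rewrite -aFk image_set_val.
split=> //; exists r; split=> //; first by apply: set_val_inj; rewrite aFk.
by move=> s /rY; rewrite -aFk image_set_val.
Qed.

Lemma nbhs_set_val (T : topologicalType) (A : set T) (x : A) (V : set A) :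
  open A -> nbhs x V ->
  nbhs (set_val x) (set_val @` V).
Proof.
move=> oA xV; apply: (@filterS _ _ _ (set_val @` V°)).
  by move=> _ [w Vw <-]; exists w => //; exact: interior_subset.
apply: open_nbhs_nbhs; split; last by exists x.
by apply: open_set_val => //; exact: open_interior.
Qed.

(** Carries a map between subtypes to a total map of [X]; continuity survives on the image because
    [e] is an open embedding. *)
Lemma extend_map (S T : topologicalType) (e : S -> X) (f : S -> T) (e' : T ->
  X) :
  injective e -> (forall s V, nbhs s V -> nbhs (e s) (e @` V)) ->
  continuous f -> continuous e' ->
  exists k : X -> X, (forall s, k (e s) = e' (f s)) /\
    (forall s, {for e s, continuous k}).
Proof.
move=> e_inj e_open fc e'c.
pose k x := if pselect (exists s, e s = x) is left ex
  then e' (f (projT1 (cid ex))) else x.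
have kE s : k (e s) = e' (f s).
  rewrite /k; case: pselect => [ex|[]]; last by exists s.
  by case: cid => t /= /e_inj ->.
exists k; split=> // s U; rewrite kE => /e'c /fc /e_open.
by apply: filterS => _ [t Ut <-] /=; rewrite kE.
Qed.

Lemma kakutani_kakutani_on F G A B (a : homeo A A) (b : homeo B B) :
  clopen A -> clopen B -> recurrent_on F A -> recurrent_on G B ->
  (forall x, set_val (a x) = F (set_val x)) ->
  (forall x, set_val (b x) = G (set_val x)) ->
  kakutani a b -> kakutani_on F G A B.
Proof.
move=> cA cB recF recG aF bG [Y1 [Y2 [Y10 cY1 Y20 cY2 [kap kapE]]]].
(* [Y1] is a set in the subtype [A], so its points reach [X] through two nested embeddings. *)
have e_inj (C : set X) (W : set C) : injective (fun y :
  W => set_val (set_val y)).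
  by move=> x y /set_val_inj/set_val_inj.
have e_open (C : set X) (W : set C) : clopen C -> clopen W ->
    forall (s : W) V, nbhs s V ->
      nbhs (set_val (set_val s)) ((fun y : W => set_val (set_val y)) @` V).
  move=> [oC _] [oW _] s V /(nbhs_set_val oW)/(nbhs_set_val oC).
  by apply: filterS => _ [_ [y Vy <-] <-]; exists y.
have e_cts (C : set X) (W : set C) : continuous (fun y :
  W => set_val (set_val y)).
  move=> x; apply: (@continuous_comp W C X set_val set_val);
    exact: set_val_continuous.
have [k [kE kc]] := extend_map (@e_inj _ Y1) (e_open _ _ cA cY1)
  (@homeo_cts _ _ kap) (e_cts _ Y2).
have [k' [k'E k'c]] := extend_map (@e_inj _ Y2) (e_open _ _ cB cY2)
  (@homeo_inv_cts _ _ kap) (e_cts _ Y1).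
have im (C : set X) (W : set C) x : (set_val @` W) x ->
    exists y : W, set_val (set_val y) = x.
  by move=> [y Wy <-]; exists (in_set_type Wy); rewrite set_val_in.
have imI (C : set X) (W : set C) (y : W) : (set_val @` W) (set_val (set_val y)).
  by exists (set_val y) => //; exact: set_valP.
have sub (C : set X) (W : set C) : set_val @` W `<=` C.
  by move=> _ [y _ <-]; exact: set_valP.
exists (set_val @` Y1), (set_val @` Y2), k, k'; split.
- split; [|exact: clopen_set_val|exact: sub|exact: clopen_set_val|exact: sub].
  by case: Y10 => y Yy; exists (set_val y); exists y.
- by move=> _ /im[y <-]; rewrite kE k'E homeo_funK; split=> //; exact: imI.
- by move=> _ /im[y <-]; rewrite k'E kE homeo_invK; split=> //; exact: imI.
- by split=> _ /im[y <-].
move=> y y' yy'; have [/im[u uE] _ _] := yy'.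
rewrite -uE in yy' *.
have : first_return a Y1 (set_val u) (set_val (induced a u)).
  apply: induced_first_return.
  have [r r0 [z Yz zE]] :=
    recF _ (clopen_set_val cA cY1) (@sub _ _) _ (imI _ _ u).
  exists r => //; suff -> : iter r a (set_val u) = z by [].
  apply: set_val_inj; rewrite zE; elim: r {r0 zE} => //= r <-; exact: aF.
move=> /(first_return_set_val _ _ _ aF) => ua.
rewrite (first_return_uniq yy' ua) !kE kapE.
apply/(first_return_set_val _ _ _ bG); apply: induced_first_return.
have [r r0 [z Yz zE]] :=
  recG _ (clopen_set_val cB cY2) (@sub _ _) _ (imI _ _ (kap u)).
exists r => //; suff -> : iter r b (set_val (kap u)) = z by [].
apply: set_val_inj; rewrite zE; elim: r {r0 zE} => //= r <-; exact: bG.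
Qed.

Lemma kakutani_on_kakutani F G A B (a : homeo A A) (b : homeo B B) :
  clopen A -> clopen B -> recurrent_on F A -> recurrent_on G B ->
  (forall x, set_val (a x) = F (set_val x)) ->
  (forall x, set_val (b x) = G (set_val x)) ->
  kakutani_on F G A B -> kakutani a b.
Proof.
move=> cA cB recF recG aF bG.
move=> [Y [Z [k [k' [[Y0 cY YA cZ ZB] kP k'P [kc k'c] kret]]]]].
pose Y1 : set A := set_val @^-1` Y; pose Y2 : set B := set_val @^-1` Z.
have Y1E : set_val @` Y1 = Y by rewrite set_val_preimage setIC (setIidl YA).
have Y2E : set_val @` Y2 = Z by rewrite set_val_preimage setIC (setIidl ZB).
have lift (C D : set X) (V W : set X) (l : X -> X) : W `<=` D ->
    (forall y, V y -> W (l y)) -> (forall y, V y -> {for y, continuous l}) ->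
    exists f : (set_val @^-1` V : set C) -> (set_val @^-1` W : set D),
      continuous f /\ forall y,
        set_val (set_val (f y)) = l (set_val (set_val y)).
  move=> WD VW lc.
  have Vy (y : set_val @^-1` V : set C) : V (set_val (set_val y)).
    exact: (set_valP y).
  have Wy (y : set_val @^-1` V : set C) : (set_val @^-1` W : set D)
      (in_set_type (WD _ (VW _ (Vy y)))) by rewrite /= set_val_in; exact: VW.
  exists (fun y => in_set_type (Wy y)); split=> [|y];
    last by rewrite !set_val_in.
  apply: (@continuous_comp_initial _ _ _ set_val) => y.
  apply: (@continuous_comp_initial _ _ _ set_val).
  move=> {}y; apply: (@continuous_comp _ _ _ (fun y => set_val (set_val y)) l).
    apply: (@continuous_comp _ C X set_val set_val); exact: set_val_continuous.
  exact: lc.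
have [f [fc fE]] := lift A B _ _ _ ZB (fun y Yy => (kP y Yy).1) kc.
have [f' [f'c f'E]] := lift B A _ _ _ YA (fun y Yy => (k'P y Yy).1) k'c.
have fK : cancel f f'.
  by move=> y; do 2 apply: set_val_inj; rewrite f'E fE (kP _ (set_valP y)).2.
have f'K : cancel f' f.
  by move=> y; do 2 apply: set_val_inj; rewrite fE f'E (k'P _ (set_valP y)).2.
have [y0 Yy0] := Y0.
exists Y1, Y2; split.
- by exists (in_set_type (YA _ Yy0)); rewrite /Y1 /= set_val_in.
- by apply: preimage_clopen => //; exact: set_val_continuous.
- exists (in_set_type (ZB _ (kP _ Yy0).1)); rewrite /Y2 /= set_val_in.
  exact: (kP _ Yy0).1.
- by apply: preimage_clopen => //; exact: set_val_continuous.
exists (Homeo fK f'K fc f'c) => y /=; do 2 apply: set_val_inj; rewrite fE.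
have iterE (C : set X) (c : homeo C C) (H : homeo X X) r x :
    (forall x, set_val (c x) = H (set_val x)) ->
    set_val (iter r c x) = iter r H (set_val x).
  by move=> cH; elim: r => //= r <-.
have ra : first_return a Y1 (set_val y) (set_val (induced a y)).
  apply: induced_first_return.
  have [r r0 Yr] := recF _ cY YA _ (set_valP y); exists r => //.
  by rewrite /Y1 /= (iterE _ _ _ _ _ aF).
have rb : first_return b Y2 (set_val (f y)) (set_val (induced b (f y))).
  apply: induced_first_return.
  have [r r0 Yr] := recG _ cZ ZB _ (set_valP (f y)); exists r => //.
  by rewrite /Y2 /= (iterE _ _ _ _ _ bG).
move: ra rb => /(first_return_set_val _ _ _ aF) + /(first_return_set_val _ _ _
  bG).
rewrite Y1E Y2E => /kret ra rb; apply: (first_return_uniq ra).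
by rewrite -fE.
Qed.

End kakutani.

(** * Transport of Kakutani equivalence along conjugacies and inversion *)

Section conjugacy.
Context {X : topologicalType}.
Implicit Types (a b g h J : homeo X X) (P Q V W Y Z : set X).
Local Open Scope ring_scope.

Lemma inv_homeoK a : inv_homeo (inv_homeo a) = a.
Proof. by case: a. Qed.

Lemma homeo_injective a : injective a.
Proof. exact: (can_inj (homeo_funK a)). Qed.

Lemma conjugate_first_return (h a psi : X -> X) P Y' Y y y' :
  (forall x, P x -> P (h x)) -> (forall x, P x -> psi (h x) = a (psi x)) ->
  Y' `<=` P -> (forall x, P x -> Y' x <-> Y (psi x)) ->
  first_return h Y' y y' -> first_return a Y (psi y) (psi y').
Proof.
move=> Ph psih YP YE [Yy Yy' [r [r0 ry rY]]].
have Py := YP _ Yy.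
have Pk k : P (iter k h y) by elim: k => //= k; exact: Ph.
have psik k : iter k a (psi y) = psi (iter k h y).
  by elim: k => //= k ->; rewrite psih.
split; [exact/YE|by apply/YE => //; exact: YP|exists r; split=> //].
  by rewrite psik ry.
by move=> s sr; rewrite psik => Ys; apply: (rY s sr); exact/YE.
Qed.

Lemma clopen_preimage_on (f : X -> X) P Y : clopen P -> clopen Y ->
  (forall x, P x -> {for x, continuous f}) -> clopen (P `&` f @^-1` Y).
Proof.
move=> [oP cP] [oY cY] fc; split.
  rewrite openE => x [Px Yfx]; rewrite /interior.
  by apply: filterS2 (near_open oP Px) (near_preimage (fc x Px) oY Yfx).
rewrite -openC openE => x nx; rewrite /interior.
have [Px|nPx] := pselect (P x).
  have nYx : (~` Y) (f x) by move=> Yx; exact: nx.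
  by apply: filterS (near_preimage (fc x Px) (closed_openC cY) nYx) => y nY [].
by apply: filterS (near_open (closed_openC cP) nPx) => y nP [].
Qed.

Lemma conjugate_on_inv h J P : (forall x, P x -> P (homeo_inv h x)) ->
  conjugate_on h J P -> conjugate_on (inv_homeo h) (inv_homeo J) P.
Proof.
move=> Phi [psi [psi' [Ppsi psiK psic psih]]]; exists psi, psi';
  split=> // x Px.
apply: (@homeo_injective J); rewrite /= homeo_invK -psih ?homeo_invK //.
exact: Phi.
Qed.

Lemma kakutani_on_inv a b P Q :
  kakutani_on a b P Q -> kakutani_on (inv_homeo a) (inv_homeo b) P Q.
Proof.
move=> [Y [Z [k [k' [H1 H2 H3 H4 kret]]]]]; exists Y, Z, k, k'; split=> // y y'.
move=> /first_return_inv; rewrite inv_homeoK => /kret; exact: first_return_inv.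
Qed.

(** [Y] and [Z] are pulled back along the conjugacies and [k] becomes [phi' \o k \o psi]. This
    passes from the induced maps of [g] to [h]. *)
Lemma conjugate_kakutani_on h h' a b P Q : clopen P -> clopen Q ->
  (forall x, P x -> P (h x)) -> (forall x, Q x -> Q (b x)) ->
  (forall x, Q x -> Q (h' x)) ->
  conjugate_on h a P -> conjugate_on h' b Q ->
  kakutani_on a b P Q -> kakutani_on h h' P Q.
Proof.
move=> cP cQ Ph Qb Qh' [psi [psi' [Ppsi psiK psic psih]]].
move=> [phi [phi' [Qphi phiK phic phih]]].
move=> [Y [Z [k [k' [[[y0 Yy0] cY YP cZ ZQ] kP k'P [kc k'c] kret]]]]].
exists (P `&` psi @^-1` Y), (Q `&` phi @^-1` Z), (phi' \o k \o psi),
  (psi' \o k' \o phi); split.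
- split; try by move=> x [].
  + have Py0 := YP _ Yy0; exists (psi' y0); split; first exact: (Ppsi _ Py0).2.
    by rewrite /= (psiK _ Py0).2.
  + by apply: clopen_preimage_on => // x /psic[].
  + by apply: clopen_preimage_on => // x /phic[].
- move=> y [Py Yy] /=; have [Zk kK] := kP _ Yy; have Qk := ZQ _ Zk.
  by rewrite (phiK _ Qk).2 kK (psiK _ Py).1; split=> //; split=> //;
    exact: (Qphi _ Qk).2.
- move=> z [Qz Zz] /=; have [Yk kK] := k'P _ Zz; have Pk := YP _ Yk.
  by rewrite (psiK _ Pk).2 kK (phiK _ Qz).1; split=> //; split=> //;
    exact: (Ppsi _ Pk).2.
- split=> [y [Py Yy]|z [Qz Zz]].
    have [Zk kK] := kP _ Yy; apply: continuous_comp; first exact: (psic _ Py).1.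
    apply: continuous_comp; first exact: kc.
    exact: (phic _ (ZQ _ Zk)).2.
  have [Yk kK] := k'P _ Zz; apply: continuous_comp; first exact: (phic _ Qz).1.
  apply: continuous_comp; first exact: k'c.
  exact: (psic _ (YP _ Yk)).2.
move=> y y' yy'; apply: (@conjugate_first_return b h' phi' Q Z) => //.
- move=> z Qz; rewrite -{1}(phiK _ Qz).2 -phih ?(phiK _ _).1 //;
  last exact: (Qphi _ Qz).2.
  by apply: Qh'; exact: (Qphi _ Qz).2.
- move=> z Qz; rewrite /= (phiK _ Qz).2; split=> [Zz|[]//].
  by split=> //; exact: (Qphi _ Qz).2.
- apply: kret; apply: (@conjugate_first_return h a psi P) yy' => //.
  by move=> x Px; split=> [[]|].
Qed.

End conjugacy.

(** * Inducing in stages *)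

Section induced.
Context {X : topologicalType} (g J : homeo X X) (P : set X).
Context (gJ : forall x, P x -> first_return g P x (J x)).
Implicit Types (V : set X).

(** The [g]-orbit can visit [V] only at visits to [P], that is, at steps of [J]; the [g]-times
    between them add up by induction on their number. *)
Lemma first_return_trans V x y : V `<=` P ->
  first_return J V x y -> first_return g V x y.
Proof.
move=> VP [Vx Vy [n [n0 ny nV]]]; split=> //.
have Px := VP _ Vx; rewrite -ny {ny Vx}.
elim: n x Px n0 nV => [//|n IH] x Px _ nV.
have [_ PJx [r [r0 rx rP]]] := gJ Px.
case: n IH nV => [|n] IH nV.
  by exists r; split=> // s /rP nP /VP.
have [||r' [r'0 r'x r'V]] := IH (J x) PJx => //.
  by move=> s sn; rewrite -iterSr; apply: nV; lia.
exists (r' + r)%N; split; first by lia.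
  by rewrite iterD rx r'x -iterSr.
move=> s sr; have [s_r|r_s|->] := ltngtP s r.
- by move=> /VP; apply: rP; lia.
- have -> : s = (s - r + r)%N by lia.
  by rewrite iterD rx; apply: r'V; lia.
- by rewrite rx; exact: (nV 1%N).
Qed.

(** Strong induction on [k], peeling off the first return, whose time is locally constant.
    Positivity of [n] is kept because first returns demand it. *)
Lemma iter_induced k x : clopen P -> P x -> P (iter k g x) ->
  exists2 n, (0 < k)%N -> (0 < n)%N &
    \forall y \near x, iter k g y = iter n J y.
Proof.
move=> cP; elim/ltn_ind: k x => k IH x Px Pk.
have [->|k0] := posnP k; first by exists 0%N => //; exact: nearW.
have [r [r0 rx rP nr]] := first_return_near cP (gJ Px).
have [_ PJx _] := gJ Px.
have rk : (r <= k)%N.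
  by rewrite leqNgt; apply/negP => kr; apply: (rP k) => //; lia.
have [|||n n0 nE] := IH (k - r)%N _ (J x) => //; first by lia.
  by rewrite -rx -iterD subnK.
exists n.+1 => //.
have nJ := near_fun _ _ _ (@homeo_cts _ _ J x) nE.
apply: filterS2 nJ nr => y yJ ry; have [Py _ _] := ry.
rewrite iterSr -yJ (first_return_uniq (gJ Py) ry).
by rewrite -iterD subnK.
Qed.

End induced.

(** * Pieces on which [g] and [h] have the same orbits *)

Section orbitwise_equal.
Context {X : topologicalType} (g h : homeo X X).
Context (compactX : compact [set: X]) (min_g : minimal_on g setT)
  (aper_h : aperiodic h) (gh : full_group g h).
Implicit Types (P Q V : set X).
Local Open Scope ring_scope.

Lemma induced_on P : clopen P -> exists J : homeo X X,
  [/\ forall x, P x -> first_return g P x (J x), forall x, P x -> P (J x)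
    & forall x, P x -> P (homeo_inv J x)].
Proof.
move=> cP; have [oP _] := cP.
have [||J [JP JN]] := @induced_homeo X g P cP.
- move=> x Px; apply: (minimal_on_enter min_g closedT oP _ (I : setT x)).
  by exists x.
- move=> x Px.
  apply: (minimal_on_enter_back min_g closedT compactX oP _ (I : setT x)).
  by exists x.
exists J; split=> // x Px; first by case: (JP x Px).
(* [J] is the identity off [P], so a preimage outside [P] would equal [x]. *)
apply: contrapT => nP; apply: (nP); rewrite -{1}(JN _ nP) homeo_invK.
exact: Px.
Qed.

Lemma induced_local_power P (J : homeo X X) (f : X -> X) x : clopen P ->
  (forall x, P x -> first_return g P x (J x)) ->
  P x -> P (f x) -> local_power g f x -> local_power J f x.
Proof.
move=> cP gJ Px Pf lf; have fc := local_power_continuous lf.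
have [n fn] := lf; have fxn := nbhs_singleton fn; case: n fn fxn => k fk fxk.
  have [|n _ nE] := iter_induced gJ cP Px (k := k).
    by move: Pf; rewrite fxk.
  by exists (Posz n); apply: filterS2 fk nE => y ->.
(* For a negative exponent, argue at [f x], from which a positive power of [g] leads back to [x],
   and invert the resulting power of [J]. *)
have gf : \forall y \near x, iter k.+1 g (f y) = y.
  apply: filterS fk => y ->; exact: (zpowKN g (Posz k.+1)).
have [|n _ nE] := iter_induced gJ cP Pf (k := k.+1).
  by rewrite (nbhs_singleton gf).
exists (- Posz n); have := near_fun _ _ _ fc nE.
apply: filterS2 gf => y -> yn; rewrite {2}yn.
by rewrite -[iter n J (f y)]/(zpow J n (f y)) zpowNK.
Qed.

(** Some [g^r] takes a point of [P] into [Q]. It maps [V] onto [W] and commutes with [g], so it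
    respects first [g]-returns, and inducing in stages identifies these with the returns of [JP] and
    [JQ]. *)
Lemma induced_kakutani_on P Q (JP JQ : homeo X X) : clopen P -> clopen Q ->
  P !=set0 -> Q !=set0 ->
  (forall x, P x -> first_return g P x (JP x)) ->
  (forall x, Q x -> first_return g Q x (JQ x)) ->
  kakutani_on JP JQ P Q.
Proof.
move=> cP cQ [p Pp] [q Qq] gJP gJQ.
have [oQ _] := cQ.
have [|r _ Qr] := minimal_on_enter min_g closedT oQ _ (I : setT p).
  by exists q.
have gc := @iter_cts _ g r (@homeo_cts _ _ g).
have gic := @iter_cts _ (inv_homeo g) r (@homeo_cts _ _ (inv_homeo g)).
have gK x : iter r (inv_homeo g) (iter r g x) = x by exact: iter_inv.
have gKi x : iter r g (iter r (inv_homeo g) x) = x.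
  by rewrite (iter_inv (inv_homeo g)).
pose V := P `&` iter r g @^-1` Q; pose W := Q `&` iter r (inv_homeo g) @^-1` P.
have cV : clopen V by apply: clopenI => //; exact: preimage_clopen.
have cW : clopen W by apply: clopenI => //; exact: preimage_clopen.
have VP : V `<=` P by move=> x [].
have WQ : W `<=` Q by move=> x [].
exists V, W, (iter r g), (iter r (inv_homeo g)); split.
- by split=> //; exists p.
- by move=> y [Py Qy]; rewrite gK; split=> //; split=> //=; rewrite gK.
- by move=> z [Qz Pz]; rewrite gKi; split=> //; split=> //=; rewrite gKi.
- by split=> y _; [exact: gc|exact: gic].
move=> y y' /(first_return_trans gJP VP) yy'.
have [Wy Wy' [s [s0 sy sW]]] : first_return g W (iter r g y) (iter r g y').
  apply: (@conjugate_first_return X g g (iter r g) setT V) yy' => //.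
  - by move=> x _; rewrite -iterSr -iterS.
  - by move=> x _; rewrite /V /W /= gK; split=> -[].
have [|n n0 nE] := iter_induced gJQ cQ (WQ _ Wy) (k := s).
  by rewrite sy; exact: WQ.
have [|z yz] := @first_return_ex X JQ W _ Wy.
  exists n; first exact: n0.
  by rewrite -(nbhs_singleton nE) sy.
suff -> : iter r g y' = z by [].
have gz := first_return_trans gJQ WQ yz.
by apply: first_return_uniq gz; split=> //; exists s.
Qed.

(** On [P], [h] is a local power of [g] that stays in [P], hence of [J]; and [J]-orbits lie in
    [g]-orbits, hence in [h]-orbits. Thus [minimal_orbit_equivalence] applies. *)
Lemma orbitwise_equal_conjugate P : clopen P -> minimal_on h P ->
  (forall x y, P x -> P y -> zorbit g x y -> zorbit h x y) ->
  exists J : homeo X X, [/\ forall x, P x -> first_return g P x (J x),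
    forall x, P x -> P (J x), forall x, P x -> P (homeo_inv J x)
    & conjugate_on h J P \/ conjugate_on h (inv_homeo J) P].
Proof.
move=> cP mP gP; have [J [gJ PJ PJi]] := induced_on cP.
exists J; split=> //; apply: minimal_orbit_equivalence => //.
- by apply: subclosed_compact compactX _ => //; case: cP.
- move=> x Px; apply: (induced_local_power cP) => //.
    by case: mP => Ph _ _; exact: Ph.
  exact: (full_group_local_power _ gh).
move=> x Px y [n _ <-]; have PJz m : P (zpow J m x) by exact: invariant_zpow.
apply: gP => //.
have gJz z : P z -> zorbit g z (J z).
  by move=> /gJ[_ _ [r [_ <- _]]]; exists (Posz r).
elim: n => [|n IH|n IH]; first exact: zorbit_refl.
  rewrite (zorbit_eq IH); have -> : n.+1%:Z = n%:Z + 1 by lia.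
  by rewrite zpowS; exact: gJz.
have := gJz _ (PJz (- n.+1%:Z)); rewrite -zpowS.
have -> : - n.+1%:Z + 1 = - n%:Z by lia.
by move=> e; rewrite (zorbit_eq IH) -(zorbit_eq e); exact: zorbit_refl.
Qed.

Lemma orbitwise_equal_flip_kakutani P Q : clopen P -> clopen Q ->
  P !=set0 -> Q !=set0 -> minimal_on h P -> minimal_on h Q ->
  (forall x y, P x -> P y -> zorbit g x y -> zorbit h x y) ->
  (forall x y, Q x -> Q y -> zorbit g x y -> zorbit h x y) ->
  kakutani_on h h P Q \/ kakutani_on h (inv_homeo h) P Q.
Proof.
move=> cP cQ P0 Q0 mP mQ gP gQ.
have [JP [gJP PJP PJPi conjP]] := orbitwise_equal_conjugate cP mP gP.
have [JQ [gJQ QJQ QJQi conjQ]] := orbitwise_equal_conjugate cQ mQ gQ.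
have kPQ := induced_kakutani_on cP cQ P0 Q0 gJP gJQ.
have kPQi := kakutani_on_inv kPQ.
have [Ph Phi _] := mP; have [Qh Qhi _] := mQ.
(* Two equal orientations cancel, by inverting the equivalence of [JP] and [JQ] if both are
   reversed; opposite ones leave a flip. *)
case: conjP conjQ => [conjP|conjP] [conjQ|conjQ].
- by left; exact: conjugate_kakutani_on kPQ.
- right; apply: conjugate_kakutani_on kPQ => //.
  by rewrite -(inv_homeoK JQ); exact: conjugate_on_inv.
- right; apply: conjugate_kakutani_on kPQi => //.
  exact: conjugate_on_inv.
- by left; exact: conjugate_kakutani_on kPQi.
Qed.

End orbitwise_equal.

(** * One orbit per piece *)

Section counting.

(** Enumerations by ordinals reduce comparisons of counts to injections between finite types. *)
Lemma card_ordinal (T : Type) (A : set T) n :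
  A #= `I_n <-> exists2 P : 'I_n -> T, injective P & range P = A.
Proof.
split=> [|[P Pinj <-]].
  rewrite card_eq_sym => /card_bijP[f [f' fK f'K]].
  pose e (i : 'I_n) : `I_n := SigSub (mem_set (ltn_ord i : `I_n i)).
  exists (fun i => val (f (e i))).
    by move=> i j /val_inj/(can_inj fK)/(congr1 val) /= /val_inj.
  apply/seteqP; split=> [_ [i _ <-]|x Ax]; first exact/set_mem/(valP (f (e i))).
  pose y : A := SigSub (mem_set Ax).
  exists (Ordinal (set_mem (valP (f' y)))) => //.
  by rewrite (_ : e _ = f' y) ?f'K //; exact: val_inj.
apply: (@card_eq_trans _ _ _ _ [set: 'I_n]).
  exact: inj_card_eq (in2W Pinj).
have -> : `I_n = range (val : 'I_n -> nat).
  apply/seteqP; split=> [i In|_ [i _ <-]] /=; last exact: ltn_ord.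
  by exists (Ordinal In).
by rewrite card_eq_sym; apply: inj_card_eq => i j _ _ /val_inj.
Qed.

Context {X : topologicalType} (g h : homeo X X).
Context (min_g : minimal_on g setT) (aper_h : aperiodic h)
  (gh : full_group g h).
Local Open Scope ring_scope.

Lemma full_group_zorbit x y : zorbit g x y -> zorbit h y `<=` zorbit g x.
Proof.
move=> xy _ [n _ <-]; rewrite (zorbit_eq xy).
have [||//||m nm] := @local_power_zpow X h g setT n y => //.
  by move=> z _; exact: (full_group_local_power _ gh).
by rewrite (nbhs_singleton nm); exact: zorbit_zpow.
Qed.

(** The [g]-orbit of [x] meets every open piece, and invariant disjoint pieces give different
    [h]-orbits. The injection [s] yields the lower bound [m <= k], and one [h]-orbit per piece when
    [m = k]. *)
Lemma orbit_transversal m k (P : 'I_m -> set X) (x : X) :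
  (forall i, open (P i)) -> (forall i, P i !=set0) ->
  (forall i, h @` P i = P i) -> trivIset setT P ->
  orbit_number g h k ->
  exists (z : 'I_m -> X) (s : 'I_m -> 'I_k) (Q : 'I_k -> set X),
  [/\ forall i, P i (z i), forall i, Q (s i) = zorbit h (z i), injective s
    & forall y, zorbit g x y -> exists j, Q j = zorbit h y].
Proof.
move=> oP P0 hP tP /(_ x)/card_ordinal[Q Qinj QE].
have QP y : zorbit g x y -> exists j, Q j = zorbit h y.
  move=> xy; suff : range Q (zorbit h y) by move=> [j _ <-]; exists j.
  rewrite QE; split; first exact: (@aper_h y).
  by exists y => //; exact: full_group_zorbit.
have zP i : {z | P i z /\ zorbit g x z}.
  apply: cid; have [|r _ Pr] := minimal_on_enter min_g closedT (oP i) _ (I :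
    setT x).
    by rewrite setTI.
  by exists (iter r g x); split=> //; exists (Posz r).
pose z i := sval (zP i).
have Pz i : P i (z i) by rewrite /z; case: (zP i) => ? [].
have xz i : zorbit g x (z i) by rewrite /z; case: (zP i) => ? [].
pose s i := sval (cid (QP _ (xz i))).
have Qs i : Q (s i) = zorbit h (z i) by rewrite /s; case: cid.
exists z, s, Q; split=> // i j sij.
have : zorbit h (z i) (z j) by rewrite -Qs sij Qs; exact: zorbit_refl.
move=> [n _ zn]; apply: (tP i j I I); exists (z j); split=> //.
have [Ph Phi] := (image_invariant h (P i)).1 (hP i).
by rewrite -zn; exact: invariant_zpow.
Qed.

End counting.

(** * From strongly p.p.m. to a partition *)

Section strongly_ppm_pieces.
Context {X : topologicalType} (h : homeo X X).
Context (compactX : compact [set: X]) (hausdorffX : hausdorff_space X)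
  (aper_h : aperiodic h).

Lemma restr_inv_val A (hA : h @` A = A) (x : A) :
  set_val (inv_homeo (restr h hA) x) = inv_homeo h (set_val x).
Proof. by []. Qed.

Lemma flip_kakutani_restr A B (hA : h @` A = A) (hB : h @` B = B) :
  clopen A -> clopen B -> minimal_on h A -> minimal_on h B ->
  flip_kakutani (restr h hA) (restr h hB) <->
  kakutani_on h h A B \/ kakutani_on h (inv_homeo h) A B.
Proof.
move=> cA cB mA mB; have [_ clA] := cA; have [_ clB] := cB.
have coB : compact B by apply: subclosed_compact compactX _.
have rA := minimal_on_recurrent clA mA; have rB := minimal_on_recurrent clB mB.
have rBi := minimal_on_recurrent clB (minimal_on_inv clB coB mB).
have vA := set_val_restr hA; have vB := set_val_restr hB.
have vBi := restr_inv_val hB.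
split=> -[kAB|kAB]; [left|right|left|right].
- exact: kakutani_kakutani_on vA vB kAB.
- exact: kakutani_kakutani_on vA vBi kAB.
- exact: kakutani_on_kakutani vA vB kAB.
- exact: kakutani_on_kakutani vA vBi kAB.
Qed.

(** The common [n] expresses [o_g(h) = m(h)]. The pieces are the infinite minimal orbit closures;
    they cover because every orbit closure is of this kind. *)
Lemma strongly_ppm_partition (g : homeo X X) n : [set: X] !=set0 ->
  minimal_on g setT -> full_group g h -> orbit_number g h n ->
  infinite_minimal_orbit_closures h #= `I_n ->
  exists (P : 'I_n -> set X) (hP : forall i, h @` P i = P i),
    [/\ classical_sets.partition [set: 'I_n] P [set: X],
        forall i, clopen (P i),
        forall i, compact_minimal (restr h (hP i))
      & forall i j, flip_kakutani (restr h (hP i)) (restr h (hP j))].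
Proof.
move=> X0 min_g gh og /card_ordinal[P Pinj PE].
have C_clopen x : clopen (closure (zorbit h x)).
  exact: (orbit_closure_clopen compactX hausdorffX min_g).
have C_min x : minimal_on h (closure (zorbit h x)).
  exact: (orbit_closure_minimal compactX hausdorffX min_g).
have C_eq x y : closure (zorbit h x) y ->
    closure (zorbit h y) = closure (zorbit h x).
  exact: (orbit_closure_eq compactX hausdorffX min_g).
have C_refl x : closure (zorbit h x) x by apply: subset_closure;
  exact: zorbit_refl.
have C_inf x : infinite_set (closure (zorbit h x)).
  by move=> fin; apply: (@aper_h x); apply: sub_finite_set fin;
    exact: subset_closure.
have hC x : h @` closure (zorbit h x) = closure (zorbit h x).
  by apply/image_invariant; exact: orbit_closure_invariant.
have PC i : exists x, P i = closure (zorbit h x).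
  have : range P (P i) by exists i.
  by rewrite PE => -[[x ->] _ _]; exists x.
have hP i : h @` P i = P i by have [x ->] := PC i; exact: hC.
have cP i : clopen (P i) by have [x ->] := PC i; exact: C_clopen.
have mP i : minimal_on h (P i) by have [x ->] := PC i; exact: C_min.
have P0 i : P i !=set0 by have [x ->] := PC i; exists x; exact: C_refl.
have Pz i z : P i z -> P i = closure (zorbit h z).
  by have [x ->] := PC i => /C_eq.
have tP : trivIset setT P.
  by move=> i j _ _ [z [/Pz Piz /Pz Pjz]]; apply: Pinj; rewrite Piz Pjz.
(* An injection of ['I_n] into itself is onto, so each [h]-orbit in the [g]-orbit of [x] passes
   through some [z k]; disjointness forces [k = i] inside [P i]. *)
have P_orbit i x y : P i x -> P i y -> zorbit g x y -> zorbit h x y.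
  move=> Px Py xy.
  have [z [s [Q [zP Qs s_inj QP]]]] :=
    orbit_transversal min_g aper_h gh x (fun i => (cP i).1) P0 hP tP og.
  have onP t : P i t -> zorbit g x t -> zorbit h t = zorbit h (z i).
    move=> Pt /QP[j Qj]; have /codomP[k jk] := injF_onto s_inj j.
    suff ik : i = k by rewrite ik -Qs -jk Qj.
    have : zorbit h t (z k) by rewrite -Qj jk Qs; exact: zorbit_refl.
    move=> [l _ lz]; apply: (tP i k I I); exists (z k); split=> //.
    have [Ph Phi] := (image_invariant h (P i)).1 (hP i).
    by rewrite -lz; exact: invariant_zpow.
  rewrite (onP x) //; last exact: zorbit_refl.
  by rewrite -(onP y) //; exact: zorbit_refl.
exists P, hP; split=> //.
- split=> //; apply/seteqP; split=> // x _.
  have : infinite_minimal_orbit_closures h (closure (zorbit h x)).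
    split; [by exists x|exact: C_inf|exists (hC x)].
    apply/(minimal_restr (hC x) (C_clopen x).2).
    by split; [exists x; exact: C_refl|exact: C_min].
  by rewrite -PE => -[i _ Pi]; exists i => //; rewrite Pi; exact: C_refl.
- move=> i; apply/(compact_minimal_restr (hP i) compactX hausdorffX (cP i).2).
  by split=> //; have [x ->] := PC i; exact: C_inf.
- move=> i j; apply/(flip_kakutani_restr (hP i) (hP j)) => //.
  apply: (orbitwise_equal_flip_kakutani compactX min_g aper_h gh) => //;
    exact: P_orbit.
Qed.

End strongly_ppm_pieces.

(** * Gluing Kakutani equivalent pieces *)

Section gluing.
Context {X : topologicalType}.
Implicit Types (F G : homeo X X) (A B S Y Z : set X).

Definition comp_homeo F G : homeo X X.
Proof.
refine (@Homeo X X (F \o G) (homeo_inv G \o homeo_inv F) _ _ _ _).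
- by move=> x /=; rewrite !homeo_funK.
- by move=> x /=; rewrite !homeo_invK.
- by move=> x; apply: continuous_comp; exact: homeo_cts.
- by move=> x; apply: continuous_comp; exact: homeo_inv_cts.
Defined.

Lemma patch_continuous (f f' : X -> X) S x : clopen S ->
  (S x -> {for x, continuous f}) -> (~ S x -> {for x, continuous f'}) ->
  {for x, continuous (fun y => if pselect (S y) then f y else f' y)}.
Proof.
move=> [oS cS] fc f'c; have [Sx|nSx] := pselect (S x).
  apply: near_eq_continuous (fc Sx).
  by apply: filterS (near_open oS Sx) => y Sy; case: pselect.
apply: near_eq_continuous (f'c nSx).
by apply: filterS (near_open (closed_openC cS) nSx) => y nS; case: pselect.
Qed.

Lemma swap_homeo Y Z (k k' : X -> X) : clopen Y -> clopen Z ->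
  (forall x, Y x -> ~ Z x) ->
  (forall y, Y y -> Z (k y) /\ k' (k y) = y) ->
  (forall z, Z z -> Y (k' z) /\ k (k' z) = z) ->
  (forall y, Y y -> {for y, continuous k}) ->
  (forall z, Z z -> {for z, continuous k'}) ->
  exists s : homeo X X, [/\ forall y, Y y -> s y = k y,
    forall z, Z z -> s z = k' z & forall x, ~ Y x -> ~ Z x -> s x = x].
Proof.
move=> cY cZ YZ kP k'P kc k'c.
pose s x := if pselect (Y x) then k x else if pselect (Z x) then k' x else x.
have sY y : Y y -> s y = k y by move=> Yy; rewrite /s; case: pselect.
have sZ z : Z z -> s z = k' z.
  by move=> Zz; rewrite /s; case: pselect => [/YZ //|?]; case: pselect.
have sN x : ~ Y x -> ~ Z x -> s x = x.
  by move=> nY nZ; rewrite /s; do 2 case: pselect => //.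
have sK : cancel s s.
  move=> x; have [Yx|nYx] := pselect (Y x).
    by have [Zk kK] := kP _ Yx; rewrite (sY _ Yx) (sZ _ Zk).
  have [Zx|nZx] := pselect (Z x); last by rewrite !sN.
  by have [Yk kK] := k'P _ Zx; rewrite (sZ _ Zx) (sY _ Yk).
have sc : continuous s.
  move=> x; apply: patch_continuous => // [|_]; first exact: kc.
  by apply: patch_continuous => // [|_]; [exact: k'c|exact: cvg_id].
by exists (Homeo sK sK sc sc).
Qed.

(* From [x] the map [G] jumps to [y], follows [F] there for [t] steps outside
   [S], and only then comes back. *)
Lemma excursion_first_return (F G : X -> X) S x y t :
  S x -> G x = y -> (0 < t)%N ->
  (forall i, (i < t)%N -> ~ S (iter i F y)) ->
  (forall i, (i.+1 < t)%N -> G (iter i F y) = iter i.+1 F y) ->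
  S (G (iter t.-1 F y)) -> first_return G S x (G (iter t.-1 F y)).
Proof.
case: t => // t Sx Gx _ nS GF SG; split=> //; exists t.+2.
have GE i : (i < t.+1)%N -> iter i G y = iter i F y.
  by elim: i => // i IH it; rewrite iterS IH; [exact: GF|lia].
split=> //; first by rewrite iterSr Gx iterS GE.
by case=> // s st; rewrite iterSr Gx GE; [apply: nS; lia|lia].
Qed.

Lemma first_return_local_power F G A : clopen A ->
  (forall x, A x -> first_return G A x (F x)) ->
  forall x, A x -> local_power G F x.
Proof.
move=> cA GF x Ax; have [r [_ _ _ nr]] := first_return_near cA (GF x Ax).
exists (Posz r); apply: filterS nr => y yr; have [Ay _ _] := yr.
exact: first_return_uniq (GF y Ay) yr.
Qed.

Lemma first_return_zorbit F G A x y : clopen A ->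
  (forall x, A x -> first_return G A x (F x)) ->
  A x -> A y -> zorbit G x y -> zorbit F x y.
Proof.
move=> cA GF; have pos z t n : A z -> A t -> iter n G z = t -> zorbit F z t.
  move=> Az At zt; have [|k _ kE] := iter_induced GF cA Az (k := n).
    by rewrite zt.
  by exists (Posz k) => //; rewrite -zt (nbhs_singleton kE).
move=> Ax Ay [[n|n] _ xy]; first exact: (pos x y n).
have yx : zorbit F y x.
  by apply: (pos y x n.+1 Ay Ax); rewrite -xy; exact: (zpowKN G (Posz n.+1)).
by rewrite -(zorbit_eq yx); exact: zorbit_refl.
Qed.

(** When [F] is about to land in [Y] or [Z], [G] crosses to the other side and runs through one
    tower of the induced map there before landing. Seen from either side alone, [G] is still [F]. *)
Lemma kakutani_gluing F A B : clopen A -> clopen B -> (forall x, A x ->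
  ~ B x) ->
  compact [set: X] -> minimal_on F A -> minimal_on F B ->
  kakutani_on F F A B ->
  exists G : homeo X X,
  [/\ forall x, ~ A x -> ~ B x -> G x = F x,
      forall x, A x -> first_return G A x (F x),
      forall x, B x -> first_return G B x (F x)
    & minimal_on G (A `|` B)].
Proof.
move=> cA cB AB cX mA mB.
move=> [Y [Z [k [k' [[[y0 Yy0] cY YA cZ ZB] kP k'P [kc k'c] kret]]]]].
have [FA FiA minA] := mA; have [FB FiB minB] := mB.
have [oA clA] := cA; have [oB clB] := cB; have [oZ clZ] := cZ.
have recA := minimal_on_recurrent clA mA.
have recB := minimal_on_recurrent clB mB.
have coB : compact B by exact: subclosed_compact cX _.
have BA x : B x -> ~ A x by move=> Bx /AB.
have AY x : A x -> ~ Z x by move=> /AB nB /ZB.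
have BY x : B x -> ~ Y x by move=> /BA nA /YA.
have [||I [IZ IN]] := @induced_homeo X F Z cZ; first exact: recB.
  move=> x Zx; apply: (minimal_on_enter_back mB clB coB oZ _ (ZB _ Zx)).
  by exists x; split=> //; exact: ZB.
have [|s [sY sZ sN]] := swap_homeo cY cZ _ kP k'P kc k'c.
  by move=> x /YA /AY.
(* [I] is the map induced on [Z], and [s] exchanges [Y] and [Z]. *)
pose G := comp_homeo s (comp_homeo (inv_homeo I) F).
have GE x : G x = s (homeo_inv I (F x)) by [].
have IiN x : ~ Z x -> homeo_inv I x = x.
  by move=> nZ; apply: (@homeo_injective _ I); rewrite homeo_invK IN.
have IiZ x : Z x -> Z (homeo_inv I x).
  move=> Zx; apply: contrapT => nZ; apply: (nZ).
  by have := IN _ nZ; rewrite homeo_invK => <-.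
have GA x : A x -> ~ Y (F x) -> G x = F x.
  by move=> Ax nY; have nZ := AY _ (FA _ Ax); rewrite GE IiN // sN.
have GY x : A x -> Y (F x) -> G x = k (F x).
  by move=> Ax YF; have nZ := AY _ (FA _ Ax); rewrite GE IiN // sY.
have GB x : B x -> ~ Z (F x) -> G x = F x.
  by move=> Bx nZ; rewrite GE IiN // sN //; apply: BY; exact: FB.
have GZ x : Z (F x) -> G x = k' (homeo_inv I (F x)).
  by move=> ZF; rewrite GE sZ //; exact: IiZ.
have GN x : ~ A x -> ~ B x -> G x = F x.
  move=> nA nB.
  have nAF : ~ A (F x) by move=> /FiA; rewrite homeo_funK.
  have nBF : ~ B (F x) by move=> /FiB; rewrite homeo_funK.
  have nZF : ~ Z (F x) by move=> /ZB.
  have nYF : ~ Y (F x) by move=> /YA.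
  by rewrite GE IiN // sN.
(* If [F x] is in [Y], the excursion starts at [w = k (F x)] and stops just before [I w]; there the
   inverse of [I] gives back [w], and [s] turns it into [k' w = F x]. *)
have frA x : A x -> first_return G A x (F x).
  move=> Ax; have [YF|nY] := pselect (Y (F x)); last first.
    split=> //; first exact: FA.
    by exists 1%N; split=> //; [exact: GA|lia].
  have [Zw kK] := kP _ YF; set w := k (F x) in Zw kK.
  have [_ ZIw [t [t0 tw tZ]]] := IZ _ Zw.
  have Ft : F (iter t.-1 F w) = I w by rewrite -iterS prednK.
  have Gt : G (iter t.-1 F w) = F x by rewrite GZ Ft // homeo_funK.
  rewrite -Gt; apply: (@excursion_first_return F) => //.
  - exact: GY.
  - by move=> i _; apply: BA; apply: minimal_on_iter => //; exact: ZB.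
  - move=> i it; rewrite GB //; first by apply: minimal_on_iter => //;
    exact: ZB.
    by rewrite -iterS; apply: tZ; lia.
  - by rewrite Gt; exact: FA.
(* If [F x] is in [Z], the excursion runs from [y = k' z] to just before its return [y'] to [Y].
   Since [k] respects first returns, [k y'] is the return of [z] to [Z], namely [F x]. *)
have frB x : B x -> first_return G B x (F x).
  move=> Bx; have [ZF|nZ] := pselect (Z (F x)); last first.
    split=> //; first exact: FB.
    by exists 1%N; split=> //; [exact: GB|lia].
  set z := homeo_inv I (F x); have Zz : Z z by exact: IiZ.
  have [Yy kK] := k'P _ Zz; set y := k' z in Yy kK.
  have zF : first_return F Z z (F x).
    by have := IZ _ Zz; rewrite /z homeo_invK.
  have [y' yy'] := first_return_ex Yy (recA _ cY YA _ Yy).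
  have ky' : k y' = F x.
    by apply: first_return_uniq zF; rewrite -kK; exact: kret.
  have [_ Yy' [t [t0 ty tY]]] := yy'.
  have Ft : F (iter t.-1 F y) = y' by rewrite -iterS prednK.
  have Ait i : A (iter i F y) by apply: minimal_on_iter => //; exact: YA.
  have Gt : G (iter t.-1 F y) = F x by rewrite GY ?Ft.
  rewrite -Gt; apply: (@excursion_first_return F) => //.
  - exact: GZ.
  - by move=> i _; exact: AB.
  - by move=> i it; rewrite GA // -iterS; apply: tY; lia.
  - by rewrite Gt; exact: FB.
exists G; split=> //.
have G_iter S (K : set X) x : (forall x, K x -> K (G x)) -> K x ->
    first_return G S x (F x) -> K (F x).
  by move=> GK Kx [_ _ [r [_ <- _]]]; elim: r => //= r; exact: GK.
have kZ y : Y y -> G (homeo_inv F y) = k y.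
  move=> Yy; have Ay : A (homeo_inv F y) by apply: FiA; exact: YA.
  have YF : Y (F (homeo_inv F y)) by rewrite homeo_invK.
  by rewrite GY // homeo_invK.
have k'Y z : Z z -> G (homeo_inv F (I z)) = k' z.
  move=> Zz; have ZF : Z (F (homeo_inv F (I z))).
    by rewrite homeo_invK; case: (IZ _ Zz).
  by rewrite GZ // homeo_invK homeo_funK.
split.
- move=> x [Ax|Bx].
    have [YF|nY] := pselect (Y (F x)); last by left; rewrite GA //; exact: FA.
    by right; rewrite GY //; apply: ZB; exact: (kP _ YF).1.
  have [ZF|nZ] := pselect (Z (F x)); last by right; rewrite GB //; exact: FB.
  by left; rewrite GZ //; apply: YA; exact: (k'P _ (IiZ _ ZF)).1.
- move=> x ABx; apply: contrapT => /not_orP[nA nB].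
  have := GN _ nA nB; rewrite homeo_invK => xE.
  have : (A `|` B) (F (homeo_inv G x)) by rewrite -xE.
  case=> [/FiA|/FiB]; rewrite homeo_funK; [exact: nA|exact: nB].
move=> K clK [x0 Kx0] KAB GK.
(* [F x] is a [G]-iterate of [x], so [K] contains each side that it meets; the crossings at [y0] and
   [k y0] then carry it to the other side. *)
have KA x : K x -> A x -> A `<=` K.
  move=> Kx Ax; suff : A `<=` K `&` A by move=> AK t /AK[].
  apply: minA; [exact: closedI|by exists x|by move=> t []|].
  by move=> t [Kt At]; split; [apply: (G_iter A) => //; exact: frA|exact: FA].
have KB x : K x -> B x -> B `<=` K.
  move=> Kx Bx; suff : B `<=` K `&` B by move=> BK t /BK[].
  apply: minB; [exact: closedI|by exists x|by move=> t []|].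
  by move=> t [Kt Bt]; split; [apply: (G_iter B) => //; exact: frB|exact: FB].
have Zk := (kP _ Yy0).1.
have [AK BK] : A `<=` K /\ B `<=` K.
  case: (KAB _ Kx0) => [Ax0|Bx0].
    have AK := KA _ Kx0 Ax0; split=> //.
    apply: (KB (k y0)); last exact: ZB.
    by rewrite -kZ //; apply: GK; apply: AK; apply: FiA; exact: YA.
  have BK := KB _ Kx0 Bx0; split=> //.
  apply: (KA (k' (k y0))); last by apply: YA; exact: (k'P _ Zk).1.
  rewrite -k'Y //; apply: GK; apply: BK; apply: FiB; apply: ZB.
  by case: (IZ _ Zk).
by move=> x [/AK|/BK].
Qed.

End gluing.

(** * Flipping maps and gluing all pieces *)

Section assembling.
Context {X : topologicalType}.
Implicit Types (F G : homeo X X) (A B S Y Z : set X).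
Local Open Scope ring_scope.

Lemma minimal_on_eq F G A : (forall x, A x -> G x = F x) ->
  minimal_on F A -> minimal_on G A.
Proof.
move=> GF [FA FiA minA]; split=> [x Ax|x Ax|K cK K0 KA GK].
- by rewrite GF //; exact: FA.
- have Ay := FiA _ Ax; have := GF _ Ay; rewrite homeo_invK => <-.
  by rewrite homeo_funK.
by apply: minA => // x Kx; rewrite -GF; [exact: GK|exact: KA].
Qed.

Lemma first_return_eq (f f' : X -> X) A Y x y : (forall x, A x -> f x = f' x) ->
  (forall x, A x -> A (f x)) -> Y `<=` A ->
  first_return f Y x y -> first_return f' Y x y.
Proof.
move=> ff' fA YA [Yx Yy [r [r0 ry rY]]].
have fk k : iter k f' x = iter k f x.
  have Ak i : A (iter i f x) by elim: i => /= [|i /fA //]; exact: YA.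
  by elim: k => //= k ->; rewrite ff'.
by split=> //; exists r; split=> [||s] //; rewrite fk //; exact: rY.
Qed.

Lemma kakutani_on_eq F F' G G' A B :
  (forall x, A x -> F' x = F x) -> (forall x, A x -> A (F' x)) ->
  (forall x, B x -> G x = G' x) -> (forall x, B x -> B (G x)) ->
  kakutani_on F G A B -> kakutani_on F' G' A B.
Proof.
move=> FF AF' GG BG [Y [Z [k [k' [[Y0 cY YA cZ ZB] kP k'P kc kret]]]]].
exists Y, Z, k, k'; split=> // y y' yy'.
apply: (first_return_eq GG BG ZB); apply: kret.
exact: (first_return_eq FF AF' YA yy').
Qed.

Lemma flip_homeo (h : homeo X X) (D : set X) : clopen D ->
  (forall x, D x -> D (h x)) -> (forall x, D x -> D (homeo_inv h x)) ->
  exists f : homeo X X, (forall x, D x -> f x = homeo_inv h x) /\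
    (forall x, ~ D x -> f x = h x).
Proof.
move=> cD hD hiD.
have nD x : ~ D x -> ~ D (h x) /\ ~ D (homeo_inv h x).
  move=> nDx; split; first by move=> /hiD; rewrite homeo_funK.
  by move=> /hD; rewrite homeo_invK.
pose fl (a b : X -> X) x := if pselect (D x) then a x else b x.
have flD a b x : D x -> fl a b x = a x by move=> Dx; rewrite /fl; case: pselect.
have flN a b x : ~ D x -> fl a b x = b x by move=> Dx; rewrite /fl;
  case: pselect.
have flK : cancel (fl (homeo_inv h) h) (fl h (homeo_inv h)).
  move=> x; have [Dx|nDx] := pselect (D x).
    by rewrite (flD _ _ _ Dx) (flD _ _ _ (hiD _ Dx)) homeo_invK.
  by rewrite (flN _ _ _ nDx) (flN _ _ _ (nD _ nDx).1) homeo_funK.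
have flKi : cancel (fl h (homeo_inv h)) (fl (homeo_inv h) h).
  move=> x; have [Dx|nDx] := pselect (D x).
    by rewrite (flD _ _ _ Dx) (flD _ _ _ (hD _ Dx)) homeo_funK.
  by rewrite (flN _ _ _ nDx) (flN _ _ _ (nD _ nDx).2) homeo_invK.
have c1 : continuous (fl (homeo_inv h) h).
  by move=> x; apply: patch_continuous => // _;
    [exact: homeo_inv_cts|exact: homeo_cts].
have c2 : continuous (fl h (homeo_inv h)).
  by move=> x; apply: patch_continuous => // _;
    [exact: homeo_cts|exact: homeo_inv_cts].
by exists (Homeo flK flKi c1 c2); split=> x Dx /=; [exact: flD|exact: flN].
Qed.

Context (n : nat) (f : homeo X X) (P : 'I_n.+1 -> set X)
  (compactX : compact [set: X]) (cP : forall i, clopen (P i))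
  (tP : trivIset setT P) (mP : forall i, minimal_on f (P i))
  (kP : forall i, kakutani_on f f (P ord0) (P i)).

Let stage k := \bigcup_(i in [set i : 'I_n.+1 | (i <= k)%N]) P i.

Lemma clopen_stage k : clopen (stage k).
Proof.
split; first by apply: bigcup_open => i _; case: (cP i).
by apply: closed_bigcup => [|i _]; [exact: finite_finset|case: (cP i)].
Qed.

(** [F] remains [f] on later pieces and still induces [f] on [P ord0], so the equivalence of
    [P ord0] with the next piece is available at every stage. The last two clauses serve the full
    group and the orbit count. *)
Lemma glue_stages k : (k <= n)%N -> exists F : homeo X X,
  [/\ forall (j : 'I_n.+1) x, (k < j)%N -> P j x -> F x = f x,
      minimal_on F (stage k),
      forall x, P ord0 x -> first_return F (P ord0) x (f x),
      forall x, local_power F f x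
    & forall j x y, P j x -> P j y -> zorbit F x y -> zorbit f x y].
Proof.
have fP i x : P i x -> P i (f x) by case: (mP i) => + _ _; exact.
elim: k => [_|k IH kn].
  exists f; split=> //.
  - have -> : stage 0 = P ord0; last exact: mP.
    apply/seteqP; split=> [x [i /=]|x Px]; last by exists ord0.
    rewrite leqn0 => /eqP i0 Px; suff <- : i = ord0 by [].
    exact: val_inj.
  - by move=> x Px; split=> //; [exact: fP|exists 1%N; split=> //; lia].
  - by move=> x; exists 1; exact: nearW.
have [|F [Ff mF fr0 lF orbF]] := IH; first exact: ltnW.
pose j : 'I_n.+1 := Ordinal (kn : (k.+1 < n.+1)%N).
have jF x : P j x -> F x = f x by apply: Ff.
have disj i x : P i x -> P j x -> (i <= k)%N -> False.
  move=> Pi Pj ik; have ij : i = j by apply: tP => //; exists x.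
  by move: ik; rewrite ij ltnn.
have stage_disj x : stage k x -> ~ P j x.
  by move=> [i /= ik Pi] Pj; exact: (disj i x).
have P0stage : P ord0 `<=` stage k by move=> x Px; exists ord0.
have stageS : stage k.+1 = stage k `|` P j.
  apply/seteqP; split=> [x [i /= ik Pi]|x [[i /= ik Pi]|Pj]].
  - move: ik; rewrite leq_eqVlt => /orP[/eqP ik|ik]; last by left; exists i.
    by right; suff <- : i = j by []; exact: val_inj.
  - by exists i => //=; exact: leqW.
  - by exists j => /=.
have mFj : minimal_on F (P j) by apply: (@minimal_on_eq f) => // x; exact: jF.
(* The sets and maps of [kP j] serve again: first returns of [F] to [Y] are those of [f], by
   inducing through [P ord0]. *)
have kF : kakutani_on F F (stage k) (P j).
  move: (kP j) => [Y [Z [u [u' [[Y0 cY YA cZ ZB] uP u'P uc uret]]]]].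
  exists Y, Z, u, u'; split=> //.
    by split=> //; exact: subset_trans YA P0stage.
  move=> y y' yy'; have [Yy _ _] := yy'.
  have [w yw] := first_return_ex Yy
    (minimal_on_recurrent (cP ord0).2 (mP ord0) cY YA Yy).
  rewrite (first_return_uniq yy' (first_return_trans fr0 YA yw)).
  apply: (@first_return_eq f F (P j)) (uret _ _ yw) => //.
    by move=> x Px; rewrite jF.
  exact: fP.
have [G [GN frA frB mG]] :=
  kakutani_gluing (clopen_stage k) (cP j) stage_disj compactX
  mF mFj kF.
have GF x : local_power G F x.
  have [Ax|nA] := pselect (stage k x).
    exact: (first_return_local_power (clopen_stage k) frA).
  have [Bx|nB] := pselect (P j x).
    exact: (first_return_local_power (cP j) frB).
  exists 1.
  apply: filterS2 (near_open (closed_openC (clopen_stage k).2) nA)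
    (near_open (closed_openC (cP j).2) nB) => y nAy nBy.
  by rewrite -[zpow G 1 y]/(G y) GN.
have later_stage (i : 'I_n.+1) x : (k < i)%N -> i != j -> P i x -> G x = F x.
  move=> ki ij Px; apply: GN.
    move=> [i' /= i'k Pi']; have ii : i = i' by apply: tP => //; exists x.
    by move: ki; rewrite ii; lia.
  by move=> Pj; case/eqP: ij; apply: tP => //; exists x.
exists G; split.
- move=> i x ki Pi; have ij : i != j by apply: contraTneq ki => ->;
  rewrite ltnn.
  by rewrite (later_stage i) ?(Ff i) //; exact: ltnW.
- by rewrite stageS.
- by move=> x /fr0; exact: (first_return_trans frA P0stage).
- by move=> x; apply: (local_power_trans (F := F) (A := setT)).
(* It suffices to reduce [G]-orbits to [F]-orbits: through first returns to the old stage, through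
   those to [P j], or, on later pieces, through [G = F]. *)
- move=> i x y Px Py xy; apply: (orbF i) => //.
  have [ik|ki] := leqP i k.
    by apply: (first_return_zorbit (clopen_stage k) frA) => //; exists i.
  have [ij|ij] := eqVneq i j.
    by apply: (first_return_zorbit (cP j) frB) => //; rewrite -ij.
  apply: (first_return_zorbit (cP i) _ Px Py xy) => z Pz.
  have PF : P i (F z) by rewrite (Ff i z ki Pz); exact: fP.
  by split=> //; exists 1%N; split=> //; [exact: (later_stage i)|lia].
Qed.

End assembling.

(** * From a partition to strongly p.p.m *)

Section pieces_strongly_ppm.
Context {X : topologicalType} (h : homeo X X) (n : nat) (P : 'I_n.+1 -> set X).
Context (compactX : compact [set: X]) (hausdorffX : hausdorff_space X)
  (aper_h : aperiodic h) (hP : forall i, h @` P i = P i)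
  (coverP : forall x, exists i, P i x) (tP : trivIset setT P)
  (P0 : forall i, P i !=set0) (cP : forall i, clopen (P i))
  (mP : forall i, minimal_on h (P i))
  (kP : forall i, kakutani_on h h (P ord0) (P i) \/
    kakutani_on h (inv_homeo h) (P ord0) (P i)).
Local Open Scope ring_scope.

Let Ph i x : P i x -> P i (h x).
Proof. by case: (mP i) => + _ _; exact. Qed.

Let Phi i x : P i x -> P i (homeo_inv h x).
Proof. by case: (mP i) => _ + _; exact. Qed.

Lemma kakutani_on_refl (A : set X) : A !=set0 -> clopen A ->
  kakutani_on h h A A.
Proof.
move=> A0 cA; exists A, A, id, id; split=> //; first by split.
by split=> y _; exact: cvg_id.
Qed.

(** Invert [h] on the pieces not Kakutani equivalent to the first one as they stand. By reflexivity
    the first piece is not inverted, so the comparison with it keeps its meaning. *)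
Lemma flipped_pieces : exists f : homeo X X,
  [/\ forall i, minimal_on f (P i),
      forall i, kakutani_on f f (P ord0) (P i),
      forall x, local_power h f x
    & forall x, local_power f h x].
Proof.
pose flipped (i : 'I_n.+1) := ~ kakutani_on h h (P ord0) (P i).
pose D := \bigcup_(i in flipped) P i.
have [oD clD] : clopen D.
  split; first by apply: bigcup_open => i _; case: (cP i).
  by apply: closed_bigcup => [|i _]; [exact: finite_finset|case: (cP i)].
have [//|||f [fD fN]] := @flip_homeo X h D.
- by move=> x [i fi Px]; exists i => //; exact: Ph.
- by move=> x [i fi Px]; exists i => //; exact: Phi.
have fflip i x : flipped i -> P i x -> f x = homeo_inv h x.
  by move=> fi Px; apply: fD; exists i.
have fnflip i x : ~ flipped i -> P i x -> f x = h x.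
  move=> nfi Px; apply: fN => -[j fj Pj]; apply: nfi.
  by rewrite (tP (i := i) (j := j)) //; exists x.
have mf i : minimal_on f (P i).
  have [fi|nfi] := pselect (flipped i).
    apply: (@minimal_on_eq _ (inv_homeo h)); first by move=> x; exact: fflip.
    by apply: minimal_on_inv => //; [case: (cP i)|
      apply: subclosed_compact compactX _ => //; case: (cP i)].
  by apply: (@minimal_on_eq _ h) => // x; exact: fnflip.
exists f; split=> //.
- have f0 x : P ord0 x -> f x = h x.
    by apply: fnflip => nk; apply: nk; exact: kakutani_on_refl.
  have f0P x : P ord0 x -> P ord0 (f x) by move=> Px; rewrite f0 //; exact: Ph.
  move=> i; have [fi|nfi] := pselect (flipped i).
    case: (kP i) => // ki; apply: kakutani_on_eq ki => //.
      by move=> x Px; rewrite (fflip i).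
    by move=> x; exact: Phi.
  have ki := contrapT nfi; apply: kakutani_on_eq ki => //.
    by move=> x Px; rewrite (fnflip i).
  by move=> x; exact: Ph.
- move=> x; have [Dx|nD] := pselect (D x).
    by exists (- 1); apply: filterS (near_open oD Dx) => y /fD.
  by exists 1; apply: filterS (near_open (closed_openC clD) nD) => y /fN.
- move=> x; have [Dx|nD] := pselect (D x).
    exists (- 1); apply: filterS (near_open oD Dx) => y [i fi Py].
    apply: (@homeo_injective _ f); rewrite [RHS]homeo_invK.
    by rewrite (fflip i) ?homeo_funK //; exact: Ph.
  by exists 1; apply: filterS (near_open (closed_openC clD) nD) => y /fN.
Qed.

Lemma one_orbit_per_piece : exists g : homeo X X,
  [/\ minimal_on g setT, forall x, local_power g h x
    & forall i x y, P i x -> P i y -> zorbit g x y -> zorbit h x y].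
Proof.
have [f [mf kf hf fh]] := flipped_pieces.
have [F [_ mF _ Ff orbF]] := glue_stages compactX cP tP mf kf (leqnn n).
exists F; split.
- rewrite (_ : setT = \bigcup_(i in [set i : 'I_n.+1 | (i <= n)%N]) P i) //.
  apply/seteqP; split=> // x _; have [i Px] := coverP x; exists i => //=.
  by rewrite -ltnS.
- by move=> x; apply: (local_power_trans (F := f) (A := setT)).
- move=> i x y Px Py /(orbF i x y Px Py)[k _ <-].
  have [l kl] := @local_power_zpow X f h setT k x (fun _ _ => I) (fun _ _ => I)
    (fun y _ => hf y) I.
  by rewrite (nbhs_singleton kl); exact: zorbit_zpow.
Qed.

Lemma pieces_strongly_ppm : strongly_ppm h.
Proof.
have [x0 Px0] := P0 ord0.
have infX : infinite_set [set: X].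
  by move=> fX; apply: (@aper_h x0); exact: sub_finite_set fX.
have X0 : [set: X] !=set0 by exists x0.
have [g [mg gh g_orb]] := one_orbit_per_piece.
have min_g : minimal g by apply/minimalE.
have aper_g : aperiodic g.
  by move=> x; apply: (minimal_on_aperiodic hausdorffX infX mg).
have full_gh : full_group g h by exact: local_power_full_group.
have oP i : open (P i) by case: (cP i).
have same_piece i j x y : P i x -> P j y -> zorbit h x y -> i = j.
  move=> Px Py [k _ xy]; apply: tP => //; exists y; split=> //.
  by rewrite -xy; apply: invariant_zpow => // z; [exact: Ph|exact: Phi].
split; first by right; exists g.
exists n.+1; split.
  right; split=> //.
  (* Dense [g]-orbits meet all [n + 1] pieces, each in a single [h]-orbit. *)
  - exists g; split=> // x.
    have meet i : exists z, P i z /\ zorbit g x z.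
      have [|r _ Pr] := minimal_on_enter mg closedT (oP i) _ (I : setT x).
        by rewrite setTI.
      by exists (iter r g x); split=> //; exists (Posz r).
    pose z i := sval (cid (meet i)).
    have Pz i : P i (z i) by rewrite /z; case: cid => ? [].
    have xz i : zorbit g x (z i) by rewrite /z; case: cid => ? [].
    apply/card_ordinal; exists (fun i => zorbit h (z i)).
      move=> i j ij; apply: (same_piece _ _ (z i) (z j)) => //.
      by rewrite ij; exact: zorbit_refl.
    apply/seteqP; split=> [_ [i _ <-]|O [infO [y -> yO]]].
      split; first exact: (@aper_h (z i)).
      by exists (z i) => //; exact: full_group_zorbit.
    have [i Py] := coverP y; exists i => //; apply: zorbit_eq.
    apply: (g_orb i) => //; rewrite -(zorbit_eq (xz i)).
    by apply: yO; exact: zorbit_refl.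
  - move=> g' k /minimalE[_ mg'] gh' ok.
    have [_ [s [_ [_ _ s_inj _]]]] :=
      orbit_transversal mg' aper_h gh' x0 oP P0 hP tP ok.
    by have := leq_card s s_inj; rewrite !card_ord.
apply/card_ordinal; exists P.
  move=> i j ij; have [x Px] := P0 i.
  by apply: tP => //; exists x; split=> //; rewrite -ij.
(* Minimality makes each piece the orbit closure of any of its points, so the pieces are all the
   orbit closures there are. *)
have PC i x : P i x -> P i = closure (zorbit h x).
  move=> Px; have [oPi cPi] := cP i.
  have CP : closure (zorbit h x) `<=` P i.
    rewrite [X in _ `<=` X](closure_id _).1 //; apply: closureS.
    move=> _ [k _ <-]; apply: invariant_zpow Px => z; [exact: Ph|exact: Phi].
  apply/seteqP; split=> //; case: (mP i) => _ _; apply=> //.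
  - exact: closed_closure.
  - by exists x; apply: subset_closure; exact: zorbit_refl.
  - by case: (orbit_closure_invariant h x).
apply/seteqP; split=> [_ [i _ <-]|C [[x ->] _ _]]; last first.
  by have [i Px] := coverP x; exists i => //; exact: PC.
have [x Px] := P0 i; split; first by exists x; exact: PC.
  move=> fP; apply: (@aper_h x); apply: sub_finite_set fP.
  move=> _ [k _ <-]; apply: invariant_zpow Px => z; [exact: Ph|exact: Phi].
exists (hP i); apply/(minimal_restr (hP i) (cP i).2).
by split=> //; exists x.
Qed.

End pieces_strongly_ppm.

Theorem theorem1p9 (X : topologicalType) (h : homeo X X)
    (compactX : compact [set: X]) (hausdorffX : hausdorff_space X)
    (aperiodic_h : aperiodic h) :
  strongly_ppm h <->
  exists (m : nat) (P : 'I_m -> set X) (hP : forall i, h @` P i = P i),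
    [/\ classical_sets.partition [set: 'I_m] P [set: X],
        forall i, clopen (P i),
        forall i, compact_minimal (restr h (hP i))
      & forall i j, flip_kakutani (restr h (hP i)) (restr h (hP j))].
Proof.
split=> [[_ [n [min_n card_n]]]|[m [P [hP [[cover_P tP nP] cP mP kP]]]]].
  (* The empty space is partitioned into zero pieces. *)
  have [X0|/set0P[x _]] := eqVneq [set: X] set0.
    have P0 : 'I_0 -> False by case.
    exists 0%N, (fun=> set0), (fun i => False_ind _ (P0 i)).
    split=> [|i|i|i]; try by case: (P0 i).
    split=> [|i|i]; try by case: (P0 i).
    by rewrite X0; apply/seteqP; split=> // x [i]; case: (P0 i).
  case: min_n => [[finX _]|[_ [g [/minimalE[X0 mg] gh og]] _]].
    by case: (aperiodic_h x); exact: sub_finite_set finX.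
  by exists n; exact: (strongly_ppm_partition _ _ _ X0 mg gh og).
have coverP x : exists i, P i x.
  by have : [set: X] x by []; rewrite -cover_P => -[i _ Px]; exists i.
case: m P hP cover_P tP nP cP mP kP coverP => [|n] P hP _ tP nP cP mP kP coverP.
  (* Without pieces the space is empty: p.p.m. by its first clause, with both counts [0]. *)
  have X0 : [set: X] = set0 by apply/seteqP; split=> // x;
    case: (coverP x) => -[].
  split; first by left.
  exists 0%N; split; first by left; rewrite X0.
  apply/card_ordinal; exists P; first by case.
  apply/seteqP; split=> [_ [[]]//|C [[x _] _ _]].
  by have : [set: X] x by []; rewrite X0.
have clP i : closed (P i) by case: (cP i).
have mPi i : minimal_on h (P i).
  by have /(compact_minimal_restr (hP i) compactX hausdorffX (clP i))[] := mP i.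
apply: (pieces_strongly_ppm (P := P)) => // i; first exact: nP.
by apply/(flip_kakutani_restr compactX (hP ord0) (hP i)).
Qed.
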